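(* Let $p\ge 1$ and let $n=\sum_{\nu=1}^p n_\nu$ with $n_\nu$ natural numbers. For every $\nu\in\{1,\dots,p\}$, let $C_\nu$ be a non-empty, closed and convex subset of $\mathbb{R}^{n_\nu}$, let $\theta_\nu:\mathbb{R}^n\to\mathbb{R}$ be a function and let $K_\nu:C^{-\nu}\rightrightarrows\mathbb{R}^{n_\nu}$ be a set-valued map, where $C=\prod_{\nu=1}^p C_\nu$ and $C^{-\nu}=\prod_{\mu\ne\nu}C_\mu$. Put $K(x)=\prod_{\nu=1}^pK_\nu(x^{-\nu})$ for $x\in C$. Assume that 1. for each $\nu$, $\theta_\nu$ is continuous, and convex with respect to the variable $x^\nu$; 2. for each $\nu$, $K_\nu$ is lower semicontinuous with non-empty and convex values, and $K_\nu(C^{-\nu})$ is relatively compact; 3. the set $D=\{(x,z)\in C\times\mathbb{R}^n: x\in P_C(z)\text{ and }z\in K(x)\}$ is closed. Then the generalized Nash equilibrium problem defined by $(\theta_\nu)_\nu$ and $(K_\nu)_\nu$ admits a projected solution.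
   Context: A vector $x\in\mathbb{R}^n$ is written $x=(x^1,\dots,x^p)$ with $x^\nu\in\mathbb{R}^{n_\nu}$; $x^{-\nu}$ denotes the collection of all blocks other than the $\nu$-th, and $(x^\nu,x^{-\nu})$ denotes $x$ (no reordering of blocks). $P_C(z)=\{x\in C:\|z-x\|\le\|z-w\|\ \forall w\in C\}$ with $\|\cdot\|$ the Euclidean norm of $\mathbb{R}^n$. A set-valued map $\Phi:X\rightrightarrows Y$ is lower semicontinuous if for any $x_0$, any net $(x_i)$ converging to $x_0$ and any $y_0\in \Phi(x_0)$, there exist a subnet $(x_{\varphi(j)})_{j\in J}$ and a net $(y_j)_{j\in J}$ converging to $y_0$ with $y_j\in\Phi(x_{\varphi(j)})$ for all $j$. A vector $\hat x\in C$ is a projected solution of the generalized Nash equilibrium problem if there exists $\hat z\in\mathbb{R}^n$ such that $\hat x\in P_C(\hat z)$ and, for every $\nu$, $\hat z^\nu\in K_\nu(\hat x^{-\nu})$ and $\theta_\nu(\hat z^\nu,\hat z^{-\nu})\le\theta_\nu(z^\nu,\hat z^{-\nu})$ for all $z^\nu\in K_\nu(\hat x^{-\nu})$. *)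

(* Defs.v *)
From HB Require Import structures.
From mathcomp Require Import all_boot all_order all_algebra.
From mathcomp Require Import all_classical all_reals all_analysis.

Set Implicit Arguments.
Unset Strict Implicit.
Unset Printing Implicit Defensive.

Import Order.TTheory GRing.Theory Num.Theory.
Import numFieldNormedType.Exports.

Local Open Scope classical_set_scope.
Local Open Scope ring_scope.

Definition directed (I : Type) (le : I -> I -> Prop) : Prop :=
  [/\ inhabited I,
      (forall i, le i i),
      (forall i j k, le i j -> le j k -> le i k) &
      (forall i j, exists k, le i k /\ le j k)].

(* A net [x : I -> X] converges to [x0] iff [x @ tails le --> x0]. *)
Definition tails (I : Type) (le : I -> I -> Prop) : set_system I :=
  filter_from [set: I] (fun i => [set j | le i j]).

(* Kelley's condition for [x \o phi] to be a subnet of [x], for every net [x]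
   indexed by [I]; [phi] is not required to be monotone. *)
Definition subnet_map (I J : Type) (leI : I -> I -> Prop)
    (leJ : J -> J -> Prop) (phi : J -> I) : Prop :=
  forall i, exists j0, forall j, leJ j0 j -> leI i (phi j).

(* Lower semicontinuity of the set-valued map [Phi : A => Y], where [A] carries
   the subspace topology; the values of [Phi] outside of [A] are irrelevant. *)
Definition lsc_on (X Y : topologicalType) (A : set X) (Phi : X -> set Y)
    : Prop :=
  forall (I : Type) (leI : I -> I -> Prop) (x : I -> X) (x0 : X) (y0 : Y),
    directed leI -> (forall i, A (x i)) -> A x0 ->
    x @ tails leI --> x0 -> Phi x0 y0 ->
    exists (J : Type) (leJ : J -> J -> Prop) (phi : J -> I) (y : J -> Y),
      [/\ directed leJ, subnet_map leI leJ phi,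
          y @ tails leJ --> y0 & forall j, Phi (x (phi j)) (y j)].

(* The norm the library puts on matrices is the sup norm (with the same
   topology). *)
Definition euclid_norm (R : realType) (n : nat) (x : 'rV[R]_n) : R :=
  Num.sqrt (\sum_(i < n) x ord0 i ^+ 2).

Definition metric_proj (R : realType) (n : nat) (C : set 'rV[R]_n) (z : 'rV[R]_n)
    : set 'rV[R]_n :=
  [set x | C x /\ forall w, C w -> euclid_norm (z - x) <= euclid_norm (z - w)].

Section Blocks.
Context {R : realType} {p : nat} (d : 'I_p -> nat).

(* The block x^nu of x is the library's [submxrow x nu]. *)
Definition block_space := 'rV[R]_(\sum_(nu < p) d nu).

(* The space of the collections x^{-nu}. *)
Definition others (nu : 'I_p) : Type :=
  prod_topology (fun mu : {mu : 'I_p | mu != nu} => 'rV[R]_(d (val mu))).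

Definition other_blocks (nu : 'I_p) (x : block_space) : others nu :=
  fun mu => submxrow x (val mu).
Arguments other_blocks : clear implicits.

Lemma neq_sym_bool (nu mu : 'I_p) : nu <> mu -> mu != nu.
Proof. by move=> ne; apply/eqP => e; apply: ne. Qed.

(* The vector (y, w) of R^n whose nu-th block is y and other blocks are w. *)
Definition join_blocks (nu : 'I_p) (y : 'rV[R]_(d nu)) (w : others nu)
    : block_space :=
  \mxrow_(mu < p)
    match nu =P mu with
    | ReflectT e => ecast j 'rV[R]_(d j) e y
    | ReflectF ne => w (exist _ mu (neq_sym_bool ne))
    end.

Lemma submxrow_join_blocks nu (y : 'rV[R]_(d nu)) (w : others nu) :
  submxrow (join_blocks y w) nu = y.
Proof. by rewrite mxrowK; case: eqP => // e; rewrite eq_axiomK. Qed.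

Lemma other_blocks_join_blocks nu (y : 'rV[R]_(d nu)) (w : others nu) :
  other_blocks nu (join_blocks y w) = w.
Proof.
apply: functional_extensionality_dep => -[mu ne]; rewrite /other_blocks mxrowK /=.
case: eqP => [e|ne']; first by exfalso; move: ne; rewrite e eqxx.
by rewrite (bool_irrelevance (neq_sym_bool ne') ne).
Qed.

Lemma join_blocks_other_blocks nu (x : block_space) :
  join_blocks (submxrow x nu) (other_blocks nu x) = x.
Proof.
rewrite -[RHS]submxrowK; apply: eq_mxrow => mu.
by case: eqP => // e; case: mu / e.
Qed.

Variable C : forall nu, set 'rV[R]_(d nu).

Definition prod_set : set block_space :=
  [set x | forall nu, C (submxrow x nu)].

Definition prod_others (nu : 'I_p) : set (others nu) :=
  [set w | forall mu, C (w mu)].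

(* [K nu] stands for a set-valued map defined on [prod_others nu] only; its
   values elsewhere are never constrained nor used. *)
Variable K : forall nu, others nu -> set 'rV[R]_(d nu).

Definition prod_map (x : block_space) : set block_space :=
  [set z | forall nu, K (other_blocks nu x) (submxrow z nu)].

Definition projected_solution (theta : 'I_p -> block_space -> R)
    (x : block_space)
    : Prop :=
  prod_set x /\
  exists z : block_space,
    metric_proj prod_set z x /\
    forall nu, K (other_blocks nu x) (submxrow z nu) /\
      forall y : 'rV[R]_(d nu), K (other_blocks nu x) y ->
        theta nu (join_blocks (submxrow z nu) (other_blocks nu z)) <=
        theta nu (join_blocks y (other_blocks nu z)).

End Blocks.

Arguments block_space R {p} d.
Arguments others R {p} d nu.
Arguments other_blocks {R p d} nu x.

(* Main.v *)
(* Let F(z) = K(P_C(z)), a lower semicontinuous map with values in a fixed ball,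
   and let Psi(z, y) be the sum over nu of
   theta_nu(z) - theta_nu(y^nu, z^{-nu}) (Nikaido-Isoda).  If z in F(z) and
   Psi(z, .) <= 0 on F(z), then P_C(z) is a projected solution.  Otherwise the map
   sending z to {y in F(z) : Psi(z, y) > 0} if z in F(z), and to F(z) if not, has
   non-empty convex values; it is lower semicontinuous because the fixed points of
   F form a closed set.  By Michael's selection theorem in finite dimension (for
   convex values that need not be closed) and Brouwer's theorem it has a fixed
   point z, and then 0 < Psi(z, z) = 0.  Brouwer's theorem is deduced from
   Scarf's combinatorial lemma on a grid of the simplex. *)
Require Import Defs.
From mathcomp Require Import finmap all_boot all_order all_algebra.
From mathcomp Require Import ring lra.
Import Order.TTheory GRing.Theory Num.Theory.
Set Implicit Arguments.
Unset Strict Implicit.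
Unset Printing Implicit Defensive.

(** * Scarf's lemma *)

(** [K] is only lower semicontinuous and its values need not be closed, so continuous selections
    take the place of Kakutani's theorem for best replies. The one closedness hypothesis concerns D;
    the continuous map z -> (P_C(z), z) pulls D back to the fixed points of F. This allows the
    values to shrink there: lower semicontinuity survives when values are cut down by an open
    condition over a closed set and left alone over its open complement. The same device reappears
    inside the selection argument. The condition Psi(z, y) > 0 is convex in y because theta_nu is
    convex in its own block, but it is not closed, hence the need to handle non-closed values.
    Testing Psi on deviations of a single player recovers the equilibrium conditions, because F(z)
    is a product of blocks. *)

Section Dominating.
Variables (I X : finType) (u : I -> X -> nat).
Hypothesis u_inj : forall i, injective (u i).

(** Scarf's primitive sets: no point lies strictly above a nonempty S's minimum in all the orders
    [u i] at once. *)
Definition dominating (S : {set X}) :=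
  [forall y, exists i, [forall x in S, u i y <= u i x]].

Lemma dominatingP (S : {set X}) :
  reflect (forall y, exists i, forall x, x \in S -> u i y <= u i x)
          (dominating S).
Proof.
apply: (iffP forallP) => dS y; have := dS y.
  by case/existsP => i /forall_inP ?; exists i.
by case=> i ?; apply/existsP; exists i; apply/forall_inP.
Qed.

Lemma dominating_sub (S S' : {set X}) :
  S' \subset S -> dominating S -> dominating S'.
Proof.
move=> /subsetP sS /dominatingP dS; apply/dominatingP => y.
by have [i iP] := dS y; exists i => x /sS/iP.
Qed.

(** Testing domination on a point x of S gives an order in which x is the minimum, so the minima
    exhaust S. *)
Lemma dominating_argmin (S : {set X}) : dominating S -> S != set0 ->
  exists m : I -> X, [/\ forall i, m i \in S,
    forall i x, x \in S -> u i (m i) <= u i x & m @: setT = S].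
Proof.
move=> /dominatingP dS /set0Pn[x0 x0S].
pose m i := [arg min_(x < x0 in S) u i x].
have mS i : m i \in S by rewrite /m; case: arg_minnP.
have mmin i x : x \in S -> u i (m i) <= u i x.
  by rewrite /m; case: arg_minnP => // y _ + xS; apply.
exists m; split=> //; apply/setP => x; apply/imsetP/idP => [[i _ ->]//|xS].
have [i iP] := dS x; exists i => //; apply: (u_inj (i := i)).
by apply/eqP; rewrite eqn_leq mmin // iP.
Qed.

(* Exactly two indices a, b have the same minimum in S.  A point completing S must
   become the minimum for a or for b, and each of the two is possible in one way. *)
Lemma card_dominating_extensions (S : {set X}) :
  dominating S -> S != set0 -> #|S|.+1 = #|I| ->
  (forall j, exists y, forall i, i != j -> exists2 x, x \in S & u i x < u i y) ->
  #|[set x | (x \notin S) && dominating (x |: S)]| = 2.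
Proof.
move=> dS S0 cardS exM.
have [m [mS mmin mim]] := dominating_argmin dS S0.
(* Pigeonhole: [m] maps [I] onto S, which has one element fewer. *)
have /injectivePn[a [b ab mab]] : ~~ injectiveb m.
  apply/negP => /injectiveP minj.
  by have := card_imset (mem [set: I]) minj; rewrite mim cardsT -cardS => /eqP;
  rewrite eqn_leq ltnn andbF.
have m_inj_off j : j = a \/ j = b -> {in [set~ j] &, injective m}.
  move=> jab; apply/imset_injP; rewrite cardsC1 -cardS /=.
  rewrite -mim; apply/eqP; apply: eq_card => x; apply/imsetP/imsetP => -[i _ ->].
    by exists i.
  have [ij|ij] := eqVneq i j; last by exists i; rewrite ?inE.
  by case: jab => jab; [exists b|exists a]; rewrite ?inE ?ij jab // eq_sym.
(* Points that can join S without changing any minimum but the j-th. Only the top of [M j] for [u j]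
   may complete S there: a lower choice would be exceeded by that top in all orders. *)
pose M j := [set y | [forall i, (i != j) ==> (u i (m i) < u i y)]].
have MP j y : reflect (forall i, i != j -> u i (m i) < u i y) (y \in M j).
  rewrite inE; apply: (iffP forallP) => yM i; first exact/implyP.
  exact/implyP/yM.
have exX j : exists2 x, x \in M j & forall y, y \in M j -> u j y <= u j x.
  have [y yP] := exM j.
  have yM : y \in M j.
    by apply/MP => i /yP[x xS]; apply: leq_ltn_trans; apply: mmin.
  by case: (arg_maxnP (u j) yM) => x xM xmax; exists x.
have inX j x : j = a \/ j = b -> x \in M j -> (forall y, y \in M j -> u j y <= u j x) ->
    (x \notin S) && dominating (x |: S).
  move=> jab /MP xM xmax.
  have xj : u j x <= u j (m j).
    have /dominatingP/(_ x)[i iP] := dS.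
    have [ij|/xM] := eqVneq i j; first by rewrite -ij; apply: iP.
    by rewrite ltnNge iP.
  have xS : x \notin S.
    apply/negP => xS; have : x \in m @: setT by rewrite mim.
    case/imsetP => i _ xi.
    have [k kj mk] : exists2 k, k != j & m k = x.
      have [ij|ij] := eqVneq i j; last by exists i.
      case: jab => jab; [exists b|exists a].
      - by rewrite jab eq_sym.
      - by rewrite -mab xi ij jab.
      - by rewrite jab.
      - by rewrite mab xi ij jab.
    by have := xM _ kj; rewrite mk ltnn.
  rewrite xS; apply/dominatingP => y.
  have [yM|/negP yM] := boolP (y \in M j).
    exists j => z; rewrite in_setU1 => /predU1P[->|zS]; first exact: xmax.
    by apply: leq_trans (mmin _ _ zS); apply: leq_trans xj; apply: xmax.
  have [i ij yi] : exists2 i, i != j & u i y <= u i (m i).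
    have : y \notin M j by apply/negP.
    rewrite inE negb_forall => /existsP[i]; rewrite negb_imply -leqNgt.
    by case/andP; exists i.
  exists i => z; rewrite in_setU1 => /predU1P[->|zS]; last exact: leq_trans (mmin _ _ zS).
  exact: leq_trans (ltnW (xM _ ij)).
have [xa xaM xamax] := exX a; have [xb xbM xbmax] := exX b.
have xab : xa != xb.
  apply/eqP => xe; have /dominatingP/(_ xa)[i iP] := dS.
  have := iP _ (mS i); rewrite leqNgt => /negP; apply.
  have [ia|ia] := eqVneq i a; last exact: (MP _ _ xaM).
  by rewrite xe; apply: (MP _ _ xbM); rewrite ia.
have -> : [set x | (x \notin S) && dominating (x |: S)] = [set xa; xb]; last first.
  by rewrite cards2 xab.
apply/setP => x; rewrite [RHS]inE !in_set1 inE; apply/idP/orP; last first.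
  by case=> /eqP->; [apply: (inX a)|apply: (inX b)]; auto.
case/andP=> xS dx.
have xS0 : x |: S != set0 by apply/set0Pn; exists x; apply: setU11.
have [m' [m'S m'min m'im]] := dominating_argmin dx xS0.
(* [x |: S] has as many points as there are orders, so its minima are distinct. The new point is the
   minimum for one j only, the other minima are kept, and [m a = m b] forces j to be a or b. *)
have m'inj : injective m'.
  have /imset_injP m'inj : #|m' @: setT| == #|[set: I]|.
    by rewrite m'im cardsU1 xS cardsT -cardS.
  by move=> i j; apply: m'inj.
have /imsetP[j _ xj] : x \in m' @: setT by rewrite m'im setU11.
have m'm i : i != j -> m' i = m i /\ m' i != x.
  move=> ij.
  have m'x : m' i != x by apply: contra_neq ij; rewrite xj => /m'inj.
  have : m' i \in S by have := m'S i; rewrite in_setU1 (negPf m'x).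
  move=> m'iS; split=> //; apply: (u_inj (i := i)); apply/eqP.
  by rewrite eqn_leq mmin // m'min // setU1r.
have jab : j = a \/ j = b.
  have [<-|ja] := eqVneq j a; first by left.
  have [<-|jb] := eqVneq j b; first by right.
  move: ab; rewrite -(inj_eq m'inj).
  by rewrite (m'm a _).1 1?(m'm b _).1 1?eq_sym // mab eqxx.
have xM : x \in M j.
  apply/MP => i /m'm[<-]; rewrite ltn_neqAle m'min ?setU11 // andbT.
  by apply: contra_neq => /u_inj.
have xmax y : y \in M j -> u j y <= u j x.
  move=> /MP yM; have /dominatingP/(_ y)[i iP] := dx.
  have [<-|ij] := eqVneq i j; first by rewrite iP ?setU11.
  by have := yM _ ij; rewrite ltnNge iP // setU1r.
have uniq_max k y z : y \in M k -> (forall t, t \in M k -> u k t <= u k y) ->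
  z \in M k -> (forall t, t \in M k -> u k t <= u k z) -> y = z.
  move=> yM ymax zM zmax; apply: (u_inj (i := k)); apply/eqP.
  by rewrite eqn_leq zmax ?ymax.
by case: jab xM xmax => -> xM xmax; [left|right]; apply/eqP; apply: uniq_max xM xmax _ _.
Qed.


Variables (c : X -> I) (i0 : I).

(** Terminology of the parity argument, as for Sperner's lemma: one passes between rooms through
    doors, and [c] colours the points. *)
Definition room (S : {set X}) := dominating S && (#|S| == #|I|).
Definition door (S : {set X}) := c @: S == [set~ i0].

(** With all colours present, only the point coloured [i0] can be removed to leave a door. Otherwise
    a door obtained by removing x forces the colour of x to be repeated by a single x', and exactly
    x and x' can be removed: two doors or none. *)
Lemma odd_card_doors (S : {set X}) : #|S| = #|I| ->
  odd #|[set x in S | door (S :\ x)]| = (c @: S == setT).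
Proof.
move=> cardS; have [cS|cS] := eqVneq (c @: S) setT.
  have cinj : {in S &, injective c} by apply/imset_injP; rewrite cS cardsT cardS.
  have /imsetP[x xS xi0] : i0 \in c @: S by rewrite cS.
  suff -> : [set x in S | door (S :\ x)] = [set x] by rewrite cards1.
  apply/setP => y; rewrite !inE; apply/andP/eqP => [[yS /eqP dy]|->].
    apply/eqP; apply: contraT => yx; have : i0 \in c @: (S :\ y).
      by rewrite xi0 imset_f // !inE eq_sym yx.
    by rewrite dy !inE eqxx.
  split=> //; apply/eqP/setP => i; rewrite !inE; apply/imsetP/idP => [[z]|ii0].
    rewrite !inE => /andP[zx zS] ->; rewrite xi0.
    by apply: contra_neq zx => /cinj; apply.
  have /imsetP[z zS zi] : i \in c @: S by rewrite cS.
  exists z; rewrite // !inE zS andbT.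
  by apply: contra_neq ii0 => zx; rewrite zi zx xi0.
have [->|/set0Pn[x]] := eqVneq [set x in S | door (S :\ x)] set0; first by rewrite cards0.
rewrite inE => /andP[xS /eqP dx].
have cardSx y : y \in S -> #|S :\ y| = #|I|.-1.
  by move=> yS; rewrite -cardS (cardsD1 y S) yS.
have cxi0 : c x != i0.
  apply: contra_neq cS => cx; apply/setP => i; rewrite inE.
  have [->|ii0] := eqVneq i i0; first by rewrite -cx imset_f.
  have : i \in c @: (S :\ x) by rewrite dx !inE.
  by move=> /imsetP[y]; rewrite !inE => /andP[_ yS] ->; rewrite imset_f.
have cinj y : y \in S -> door (S :\ y) -> {in S :\ y &, injective c}.
  by move=> yS /eqP dy; apply/imset_injP; rewrite dy cardSx // cardsC1.
have /imsetP[x'] : c x \in c @: (S :\ x) by rewrite dx !inE.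
rewrite !inE => /andP[x'x x'S] cxx'.
suff -> : [set x in S | door (S :\ x)] = [set x; x'] by rewrite cards2 eq_sym x'x.
apply/setP => y; rewrite !inE; apply/andP/orP => [[yS dy]|[/eqP->|/eqP->]].
- have [|yx] := eqVneq y x; first by left.
  have [|yx'] := eqVneq y x'; first by right.
  have := cinj _ yS dy x x' _ _ cxx'.
  rewrite !inE ![_ == y]eq_sym yx yx' xS x'S => /(_ isT isT) /eqP.
  by rewrite eq_sym (negPf x'x).
- by split=> //; apply/eqP.
- split=> //; rewrite /door -dx; apply/eqP/setP => i.
  apply/imsetP/imsetP => -[z]; rewrite !inE => /andP[zx zS] ->.
    have [->|zx'] := eqVneq z x; first by exists x'; rewrite // !inE x'x.
    by exists z; rewrite // !inE zx'.
  have [->|zx'] := eqVneq z x'; first by exists x; rewrite // !inE eq_sym x'x.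
  by exists z; rewrite // !inE zx'.
Qed.

(** Double counting of the pairs of a room and one of its doors. A dominating door of the right size
    other than [S0] lies in two rooms, and [S0] in an odd number, so some room has oddly many doors
    and carries every colour. *)
Lemma room_exists (S0 : {set X}) :
  (forall S : {set X}, dominating S -> door S -> #|S|.+1 = #|I| -> S != S0 ->
     S != set0 /\ forall j, exists y, forall i, i != j ->
                     exists2 x, x \in S & u i x < u i y) ->
  dominating S0 -> door S0 -> #|S0|.+1 = #|I| ->
  odd #|[set x | (x \notin S0) && dominating (x |: S0)]| ->
  exists2 S, dominating S & c @: S = setT.
Proof.
move=> twoS dS0 doorS0 cardS0 oddS0.
pose G := [pred S : {set X} | [&& dominating S, door S & #|S|.+1 == #|I|]].
have incid : \sum_(S | room S) #|[set x in S | door (S :\ x)]|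
   = \sum_(S | G S) #|[set x | (x \notin S) && dominating (x |: S)]|.
  under eq_bigr do rewrite -sum1dep_card.
  under [RHS]eq_bigr do rewrite -sum1dep_card.
  rewrite (exchange_big_dep predT) //= [RHS](exchange_big_dep predT) //=.
  apply: eq_bigr => x _.
  rewrite (reindex_onto (fun S => x |: S) (fun S => S :\ x)) /=; last first.
    by move=> S /and3P[_ xS _]; rewrite setD1K.
  apply: eq_bigl => S; rewrite /room !setU11 /=.
  have [xS|xS] := boolP (x \in S).
    rewrite andbF; apply/negP => /andP[_ /eqP e].
    by have : x \in S; rewrite // -e !inE eqxx.
  rewrite setU1K // eqxx andbT cardsU1 xS /= add1n.
  apply/andP/andP => [[/andP[d ->] ->]|[/and3P[_ -> ->] ->]] //; split=> //.
  by rewrite andbT (dominating_sub _ d) // subsetUr.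
have : odd (\sum_(S | room S) #|[set x in S | door (S :\ x)]|).
  rewrite incid (bigD1 S0) /=; last by rewrite dS0 doorS0 cardS0 eqxx.
  rewrite oddD oddS0 addTb -dvdn2.
  apply: dvdn_sum => S /andP[/and3P[dS doorS /eqP cS] SS0].
  have [Sn0 exM] := twoS S dS doorS cS SS0.
  by rewrite card_dominating_extensions.
have [/exists_inP[S /andP[dS _] /eqP cS] _|none] :=
  boolP [exists (S | room S), c @: S == setT]; first by exists S.
rewrite -[odd _]negbK -dvdn2 dvdn_sum // => S roomS; rewrite dvdn2.
have /andP[_ /eqP cardS] := roomS; rewrite odd_card_doors //.
by apply: contra none => cS; apply/exists_inP; exists S.
Qed.

End Dominating.

(* The slack point [inr i] lies below all other points in the order i and above
   [T] in the other orders, so a subset of [T + I] encodes a pair made of a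
   subset of [T] and of the set of indices whose slack point it avoids. *)
Lemma scarf (T I : finType) (v : I -> T -> nat) (c : T -> I) (t0 : T) (i0 : I) :
  (forall i, injective (v i)) ->
  exists (S : {set T}) (C : {set I}),
    (forall y, exists2 i, i \in C & forall x, x \in S -> v i y <= v i x) /\
    (forall i, i \in C -> exists2 x, x \in S & c x = i).
Proof.
(* The margin 2 puts [B] above all shifted values [(v i t).+1]; the shift leaves 0 to the slack
   point [inr i], and [enum_rank] separates the slack points at the top. *)
move=> v_inj; pose B := (\max_(p : I * T) v p.1 p.2).+2.
pose u i (x : T + I) : nat :=
  match x with
  | inl t => (v i t).+1
  | inr j => if j == i then 0 else B + enum_rank j
  end.
have vB i t : (v i t).+1 < B by rewrite !ltnS (leq_bigmax (i, t)).
have u_inj i : injective (u i).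
  move=> [s|j] [t|k] /=.
  - by case=> /v_inj ->.
  - by case: ifP => // _ e; have := vB i s; rewrite e ltnNge leq_addr.
  - by case: ifP => // _ e; have := vB i t; rewrite -e ltnNge leq_addr.
  - have [->|ji] := eqVneq j i; have [->|ki] := eqVneq k i => //.
    by move=> /addnI /val_inj /enum_rank_inj ->.
pose c' (x : T + I) : I := match x with inl t => c t | inr j => j end.
(* The exceptional door, made of slack points only; its one completion is the [v i0]-largest point
   of [T]. *)
pose S0 : {set T + I} := inr @: [set~ i0].
have inrS0 j : (inr j \in S0) = (j != i0).
  by rewrite mem_imset ?inE // => ? ? [].
have inlS0 t : (inl t \in S0) = false by apply/imsetP => -[].
have uS0 t x : x \in S0 -> u i0 (inl t) <= u i0 x.
  by move=> /imsetP[j]; rewrite !inE => /negPf ji ->; rewrite /= ji ltnW // ltn_addr.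
have doorS0 : door c' i0 S0.
  apply/eqP/setP => i; apply/imsetP/idP => [[_ /imsetP[j + ->] ->] //|ii0].
  by exists (inr i) => //; apply: imset_f.
have domS0 : dominating u S0.
  apply/dominatingP => -[t|j]; first by exists i0 => x /uS0.
  by exists j => x _; rewrite /= eqxx.
have cardS0 : #|S0|.+1 = #|I|.
  rewrite card_imset; last by move=> ? ? [].
  by rewrite cardsC1 prednK //; apply/card_gt0P; exists i0.
have odd1 : odd #|[set x | (x \notin S0) && dominating u (x |: S0)]|.
  have [t _ tmax] := arg_maxnP (v i0) (isT : predT t0).
  suff -> : [set x | (x \notin S0) && dominating u (x |: S0)] = [set inl t].
    by rewrite cards1.
  apply/setP => x; rewrite !inE; apply/andP/eqP => [[xS /dominatingP dx]|->].
    case: x => [s|j] in xS dx *; last first.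
      have [i] := dx (inl t0); have -> : j = i0 by apply/eqP; rewrite inrS0 negbK in xS.
      move=> /(_ (inr i)); rewrite in_setU1 inrS0 /= eqxx ltn0 => H.
      suff: false by []; apply: H.
      by have [->|] := eqVneq i i0; rewrite ?eqxx ?orbT.
    have [i iP] := dx (inl t); congr inl; apply: (v_inj i0).
    apply/eqP; rewrite eqn_leq [v i0 s <= _]tmax //=.
    have [ii0|ii0] := eqVneq i i0; first by have := iP _ (setU11 _ _); rewrite ii0.
    by have := iP (inr i); rewrite setU1r ?inrS0 //= eqxx => /(_ isT).
  rewrite inlS0; split=> //; apply/dominatingP => -[s|j]; last first.
    by exists j => y _; rewrite /= eqxx.
  by exists i0 => y /setU1P[->|/uS0 uy]; [exact: tmax|exact: uy].
have [S domS doorS0' cardS SS0|S /dominatingP domS cS] :=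
    room_exists u_inj _ domS0 doorS0 cardS0 odd1.
  (* Slack points are their own colours, so a door made of slack points only would be [S0]. A point
     of [T] in S lies below [inr j] in every order but j. *)
  have [t tS] : exists t, inl t \in S.
    apply/existsP; apply: contraT; rewrite negb_exists => /forallP noT.
    case/eqP: SS0; apply/setP => -[t|j]; first by rewrite (negPf (noT t)) inlS0.
    have -> : (inr j \in S0) = (j \in c' @: S) by rewrite inrS0 (eqP doorS0') !inE.
    apply/idP/imsetP => [jS|[[t|k] kS ->//]]; first by exists (inr j).
    by have := noT t; rewrite kS.
  split; first by apply/set0Pn; exists (inl t).
  move=> j; exists (inr j) => i ij; exists (inl t) => //=.
  by rewrite eq_sym (negPf ij) ltn_addr.
exists [set t | inl t \in S], [set i | inr i \notin S]; split=> [y|i].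
  have [i iP] := domS (inl y); exists i.
    by rewrite inE; apply/negP => /iP; rewrite /= eqxx.
  by move=> x; rewrite inE => /iP.
rewrite inE => iS; have /imsetP[[t|j] xS ix] : i \in c' @: S by rewrite cS.
  by exists t; rewrite ?inE.
by rewrite ix xS in iS.
Qed.

From mathcomp Require Import all_classical all_reals all_analysis.
Import numFieldNormedType.Exports.
Local Open Scope classical_set_scope.
Local Open Scope ring_scope.

(** * Separation of convex sets *)

Lemma convex_setP (R : realType) (V : lmodType R) (A : set V) :
  convex_set A <-> forall (x y : V) (t : R), 0 <= t -> t <= 1 -> A x -> A y ->
    A (t *: x + (1 - t) *: y).
Proof.
split=> [cA x y t t0 t1 Ax Ay|cA x y l /set_mem Ax /set_mem Ay]; last first.
  by apply/mem_set; apply: (cA x y l%:num).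
by have /set_mem := cA x y (Itv01 t0 t1) (mem_set Ax) (mem_set Ay).
Qed.

Section Dot.
Context {R : realType} {n : nat}.
Implicit Types x y z : 'rV[R]_n.

Definition dot x y : R := \sum_i x ord0 i * y ord0 i.

Lemma dotC x y : dot x y = dot y x.
Proof. by apply: eq_bigr => i _; rewrite mulrC. Qed.

Lemma dotDr x y z : dot x (y + z) = dot x y + dot x z.
Proof. by rewrite -big_split; apply: eq_bigr => i _; rewrite mxE mulrDr. Qed.

Lemma dotZr x a y : dot x (a *: y) = a * dot x y.
Proof. by rewrite mulr_sumr; apply: eq_bigr => i _; rewrite mxE mulrCA. Qed.

Lemma dotNr x y : dot x (- y) = - dot x y.
Proof. by rewrite -scaleN1r dotZr mulN1r. Qed.

Lemma dotBr x y z : dot x (y - z) = dot x y - dot x z.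
Proof. by rewrite dotDr dotNr. Qed.

Lemma dot0r x : dot x 0 = 0.
Proof. by rewrite -[0](scale0r 0) dotZr mul0r. Qed.

Lemma dotBl x y z : dot (x - y) z = dot x z - dot y z.
Proof. by rewrite dotC dotBr !(dotC z). Qed.

Lemma dotZl a x y : dot (a *: x) y = a * dot x y.
Proof. by rewrite dotC dotZr dotC. Qed.

End Dot.

Lemma dot_row_mx (R : realType) m n (a b : 'rV[R]_m) (x y : 'rV[R]_n) :
  dot (row_mx a x) (row_mx b y) = dot a b + dot x y.
Proof.
rewrite /dot big_split_ord /=.
by congr +%R; apply: eq_bigr => i _; rewrite ?row_mxEl ?row_mxEr.
Qed.

(* The functional is built one coordinate at a time, so [S] need not be closed:
   its slice at coordinate 0 is separated first and, if [S] meets both open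
   sides of the slice, the missing slope is a supremum. *)
Lemma proper_separation (R : realType) n (S : set 'rV[R]_n) :
  convex_set S -> S !=set0 -> ~ S 0 ->
  exists2 p, (forall y, S y -> 0 <= dot p y) & exists2 y, S y & 0 < dot p y.
Proof.
elim: n S => [|n IH] S cS [v0 Sv0] S0.
  by case: S0; rewrite (_ : 0 = v0) //; apply/rowP => -[].
pose emb (t : R) (y : 'rV[R]_n) : 'rV[R]_(1 + n) := row_mx t%:M y.
pose fst (v : 'rV[R]_(1 + n)) : R := v ord0 ord0.
pose tl (v : 'rV[R]_(1 + n)) : 'rV[R]_n := rsubmx v.
have embE (v : 'rV[R]_(1 + n)) : v = emb (fst v) (tl v).
  rewrite /emb -[LHS](hsubmxK v); congr row_mx; apply/rowP => i.
  by rewrite !mxE ord1 eqxx mulr1n; congr (v _ _); apply: val_inj.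
have dot_emb a q t y : dot (emb a q) (emb t y) = a * t + dot q y.
  by rewrite dot_row_mx /dot big_ord1 !mxE !mulr1n.
have dotE a q v : dot (emb a q) v = a * fst v + dot q (tl v).
  by rewrite {1}(embE v) dot_emb.
have emb_conv a b s t x y : a *: emb s x + b *: emb t y
    = emb (a * s + b * t) (a *: x + b *: y).
  by rewrite !scale_row_mx add_row_mx !scale_scalar_mx -raddfD.
pose slice : set 'rV[R]_n := [set y | S (emb 0 y)].
have Sconv (x y : 'rV[R]_(1 + n)) t : 0 <= t -> t <= 1 -> S x -> S y ->
    S (t *: x + (1 - t) *: y) by move/convex_setP: cS; apply.
have cslice : convex_set slice.
  apply/convex_setP => x y t t0 t1 Sx Sy.
  have e : t *: emb 0 x + (1 - t) *: emb 0 y = emb 0 (t *: x + (1 - t) *: y).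
    by rewrite emb_conv !mulr0 addr0.
  by rewrite /slice /= -e; apply: Sconv.
have slice0 : ~ slice 0.
  by rewrite /slice /= /emb raddf0 row_mx0.
(* The segment from v to w crosses the hyperplane [fst = 0] at this point. *)
have cross v w : S v -> S w -> 0 < fst v -> fst w < 0 ->
    slice ((fst v - fst w)^-1 *: (fst v *: tl w - fst w *: tl v)).
  move=> Sv Sw v0' w0; have vw : 0 < fst v - fst w by lra.
  rewrite /slice /=.
  have t0 : 0 <= fst v / (fst v - fst w) by rewrite divr_ge0 // ltW.
  have t1 : fst v / (fst v - fst w) <= 1 by rewrite ler_pdivrMr // mul1r; lra.
  set z := _ *: _; suff <- : fst v / (fst v - fst w) *: emb (fst w) (tl w)
      + (1 - fst v / (fst v - fst w)) *: emb (fst v) (tl v) = emb 0 z.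
    by rewrite -!embE; apply: Sconv.
  rewrite emb_conv /z; congr emb; first by field; rewrite gt_eqF.
  rewrite scalerBr !scalerA -scaleNr; congr (_ *: _ + _ *: _); first by rewrite mulrC.
  by field; rewrite gt_eqF.
(* If S misses an open side of the hyperplane, plus or minus the coordinate functional separates,
   unless S lies inside the hyperplane, where induction applies. *)
have [[v Sv v_gt0]|npos] := pselect (exists2 v, S v & 0 < fst v); last first.
  have [[w Sw w_lt0]|nneg] := pselect (exists2 v, S v & fst v < 0).
    exists (emb (- 1) 0) => [y Sy|]; last first.
      by exists w => //; rewrite dotE dotC dot0r; lra.
    rewrite dotE dotC dot0r; suff : ~ (0 < fst y) by move/negP; rewrite -leNgt; lra.
    by move=> y0; apply: npos; exists y.
  have S_slice y : S y -> fst y = 0.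
    move=> Sy; apply/eqP; rewrite eq_le !leNgt.
    by apply/andP; split; apply/negP => h; [apply: npos|apply: nneg]; exists y.
  have sliceS y : S y -> slice (tl y).
    by move=> Sy; rewrite /slice /= -(S_slice y Sy) -embE.
  have [|q q0 [y Sy qy]] := IH slice cslice _ slice0.
    by exists (tl v0); apply: sliceS.
  exists (emb 0 q) => [z Sz|].
    by rewrite dotE mul0r add0r q0 //; apply: sliceS.
  by exists (emb 0 y); rewrite // dot_emb mul0r add0r.
have [[w Sw w_lt0]|nneg] := pselect (exists2 v, S v & fst v < 0); last first.
  exists (emb 1 0) => [y Sy|].
    rewrite dotE dotC dot0r; suff : ~ (fst y < 0) by move/negP; rewrite -leNgt; lra.
    by move=> y0; apply: nneg; exists y.
  by exists v => //; rewrite dotE dotC dot0r; lra.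
have [|q q0 [y Sy qy]] := IH slice cslice _ slice0.
  by eexists; apply: cross Sv Sw _ _.
(* The slope a has to satisfy [0 <= a * fst u + dot q (tl u)]: each u with [fst u > 0] bounds a from
   below, each u with [fst u < 0] from above, and [cross] shows that these bounds are compatible. *)
pose slope := [set - dot q (tl u) / fst u | u in [set u | S u /\ 0 < fst u]].
have slope_ub u : S u -> fst u < 0 -> ubound slope (- dot q (tl u) / fst u).
  move=> Su u0 _ [z [Sz z0] <-].
  have := q0 _ (cross _ _ Sz Su z0 u0).
  rewrite dotZr pmulr_rge0; last by rewrite invr_gt0; lra.
  rewrite dotBr !dotZr subr_ge0 => h.
  by rewrite ler_pdivrMr // mulrAC ler_ndivlMr //; lra.
have slope_nonempty : slope !=set0 by exists (- dot q (tl v) / fst v), v.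
have slope_sup : has_sup slope.
  by split=> //; exists (- dot q (tl w) / fst w); apply: slope_ub.
exists (emb (sup slope) q) => [z Sz|]; last first.
  by exists (emb 0 y); rewrite // dot_emb mulr0 add0r.
rewrite dotE; have [z0|z0|z0] := ltgtP (fst z) 0.
- have : sup slope <= - dot q (tl z) / fst z by apply: ge_sup => //; apply: slope_ub.
  by rewrite ler_ndivlMr //; lra.
- have : - dot q (tl z) / fst z <= sup slope.
    by apply: ub_le_sup; [case: slope_sup|exists z].
  by rewrite ler_pdivrMr //; lra.
- by rewrite z0 mulr0 add0r q0 // /slice /= -z0 -embE.
Qed.

(** * Brouwer's fixed point theorem *)

(** A discrete Brouwer theorem, from Scarf's lemma for the coordinate orders: the set S that it
    yields varies by at most n in each coordinate, and a coordinate i outside C is at most n on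
    S. *)
Lemma scarf_grid (n N : nat) (c : {ffun 'I_n.+1 -> 'I_N.+1} -> 'I_n.+1) :
  exists2 x : {ffun 'I_n.+1 -> 'I_N.+1}, (\sum_i x i = N)%N &
  forall i, (x i <= n)%N \/ exists2 y : {ffun 'I_n.+1 -> 'I_N.+1},
    (\sum_i y i = N)%N &
    c y = i /\ forall j, (x j <= y j + n)%N && (y j <= x j + n)%N.
Proof.
pose T : finType := {x : {ffun 'I_n.+1 -> 'I_N.+1} | (\sum_i x i == N)%N}.
have mkT (r : 'I_n.+1 -> nat) : (\sum_i r i = N)%N ->
    exists y : T, forall i, (val y i : nat) = r i.
  move=> sr; pose y : {ffun 'I_n.+1 -> 'I_N.+1} := [ffun i => inord (r i)].
  have yr i : (y i : nat) = r i.
    by rewrite ffunE inordK // ltnS -sr (bigD1 i) //= leq_addr.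
  have ys : (\sum_i y i == N)%N by under eq_bigr do rewrite yr; apply/eqP.
  by exists (Sub y ys) => i; rewrite SubK.
have [t0 _] : exists t : T, forall i, (val t i : nat) = (if i == ord0 then N else 0%N).
  by apply: mkT; rewrite -big_mkcond big_pred1_eq.
(* The i-th coordinate, with ties broken by [enum_rank] to make the order injective. *)
pose v (i : 'I_n.+1) (t : T) : nat := (val t i * #|T| + enum_rank t)%N.
have v_inj i : injective (v i).
  move=> s t /(congr1 (modn^~ #|T|)); rewrite !modnMDl !modn_small //.
  by move=> /val_inj/enum_rank_inj.
have v_mono i s t : (v i s <= v i t)%N -> (val s i <= val t i)%N.
  apply: contraTT; rewrite -!ltnNge => ts.
  apply: leq_trans (_ : (val t i).+1 * #|T| <= _)%N.
    by rewrite /v mulSnr ltn_add2l.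
  by apply: leq_trans (leq_addr _ _); rewrite leq_mul2r ts orbT.
have [S [C [domSC colSC]]] := scarf (fun t => c (val t)) t0 ord0 v_inj.
have [i1 i1C _] := domSC t0; have [x0 x0S _] := colSC i1 i1C.
pose m i : nat := val [arg min_(x < x0 in S) val x i] i.
have mmin i x : x \in S -> (m i <= val x i)%N.
  by rewrite /m; case: arg_minnP => // y _ + xS; apply.
have sumT (x : T) : (\sum_i val x i = N)%N by case: x => y /= /eqP.
(* Otherwise a grid point with coordinates at least [m i + 1] on C, the surplus being put on [i1],
   would exceed the minima of S in every order of C. *)
have sum_m : (N < \sum_(i in C) (m i).+1)%N.
  rewrite ltnNge; apply/negP => mN.
  pose r i : nat := ((i \in C) * (m i).+1 + (i == i1) * (N - \sum_(i in C) (m i).+1))%N.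
  have [|y yr] := mkT r.
    rewrite big_split /= (eq_bigr (fun i => if i \in C then (m i).+1 else 0%N)); last first.
      by move=> i _; case: (i \in C); rewrite ?mul1n ?mul0n.
    rewrite -big_mkcond /= [X in (_ + X)%N](bigD1 i1) //= eqxx mul1n.
    rewrite [X in (_ + (_ + X))%N]big1; last by move=> i /negPf ->.
    by rewrite addn0 subnKC.
  have [i iC iP] := domSC y.
  have [x xS xm] : exists2 x, x \in S & m i = val x i.
    by rewrite /m; case: arg_minnP => // x xS _; exists x.
  have := v_mono _ _ _ (iP x xS); rewrite -xm yr /r iC mul1n.
  by rewrite leqNgt => /negP; apply; rewrite ltnS leq_addr.
have sum_m' : (N <= \sum_(i in C) m i + n)%N.
  have : (\sum_(i in C) (m i).+1 <= \sum_(i in C) m i + n.+1)%N.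
    under eq_bigr do rewrite -addn1.
    by rewrite big_split /= leq_add2l sum1_card (leq_trans (max_card _)) ?card_ord.
  by move=> h; rewrite -ltnS -addnS; apply: leq_trans h.
(* [b] bounds S from below and its sum misses N by at most n, so a point of S exceeds [b] by at most
   n in each coordinate. *)
pose b j : nat := if j \in C then m j else 0%N.
have lower x j : x \in S -> (b j <= val x j)%N.
  by move=> xS; rewrite /b; case: ifP => // _; apply: mmin.
have sum_b : (N <= \sum_i b i + n)%N by rewrite -big_mkcond.
have upper x j : x \in S -> (val x j <= b j + n)%N.
  move=> xS; rewrite -(leq_add2r (\sum_(i | i != j) b i)%N) addnAC.
  have -> : (b j + \sum_(i | i != j) b i = \sum_i b i)%N by rewrite [RHS](bigD1 j).
  apply: leq_trans (_ : \sum_i val x i <= _)%N; last by rewrite sumT.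
  rewrite [leqRHS](bigD1 j) //= leq_add2l.
  by apply: leq_sum => i _; apply: lower.
exists (val x0) => [|i]; first exact: sumT.
have [iC|iC] := boolP (i \in C).
  right; have [y yS ci] := colSC i iC; exists (val y); first exact: sumT.
  split=> // j; have [xu yu] := (upper x0 j x0S, upper y j yS).
  by rewrite (leq_trans xu) ?leq_add2r ?lower // (leq_trans yu) ?leq_add2r ?lower.
by left; have := upper x0 i x0S; rewrite /b (negPf iC).
Qed.

(** * Convergence, continuity and compactness for row vectors, coordinate by coordinate *)

Section RowVectors.
Context {R : realType} {n : nat}.
Implicit Types x y : 'rV[R]_n.

Lemma row_norm_leP x e : 0 <= e -> (`|x| <= e) <-> (forall i, `|x ord0 i| <= e).
Proof.
move=> e0; rewrite /Num.norm /= mx_normrE; split=> [xe i|xe].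
  by move/bigmax_leP : xe => -[_ /(_ (ord0, i))]; apply.
by apply/bigmax_leP; split=> // -[i j] _ /=; rewrite ord1; apply: xe.
Qed.

Lemma coord_le_norm x i : `|x ord0 i| <= `|x|.
Proof. by move/row_norm_leP: (lexx `|x|); apply. Qed.

Lemma row_norm_ltP x e : 0 < e -> (`|x| < e) <-> (forall i, `|x ord0 i| < e).
Proof.
move=> e0; split=> [xe i|xe]; first exact: le_lt_trans (coord_le_norm x i) xe.
by rewrite /Num.norm /= mx_normrE; apply/bigmax_ltP; split=> // -[i j] _ /=; rewrite ord1; apply: xe.
Qed.

Lemma cvg_row (T : Type) (F : set_system T) {FF : Filter F} (f : T -> 'rV[R]_n) y :
  (forall i, (fun t => f t ord0 i) @ F --> y ord0 i) -> f @ F --> y.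
Proof.
move=> fy; apply/cvgrPdist_lt => e e0.
have : \forall t \near F, forall i, `|y ord0 i - f t ord0 i| < e.
  by apply: filter_forall => i; move/cvgrPdist_lt : (fy i); apply.
by apply: filterS => t h; apply/row_norm_ltP => // i; rewrite !mxE.
Qed.

Lemma continuous_row (T : topologicalType) (f : T -> 'rV[R]_n) :
  (forall i, continuous (fun t => f t ord0 i)) -> continuous f.
Proof. by move=> fc t; apply: cvg_row => i; apply: fc. Qed.

Lemma continuous_coord (T : topologicalType) (f : T -> 'rV[R]_n) i :
  continuous f -> continuous (fun t => f t ord0 i).
Proof.
move=> fc t.
apply: (@continuous_comp _ _ _ f (fun x : 'rV[R]_n => x ord0 i)); first exact: fc.
exact: coord_continuous.
Qed.

Lemma continuous_sum (T : topologicalType) (V : normedModType R) (I : Type) (s : seq I)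
    (P : pred I) (f : I -> T -> V) :
  (forall i, P i -> continuous (f i)) -> continuous (fun t => \sum_(i <- s | P i) f i t).
Proof. by move=> fc t; apply: cvg_big => [|i /fc]; [apply: add_continuous|apply]. Qed.

Lemma compact_ball0 (M : R) : compact [set x : 'rV[R]_n | `|x| <= M].
Proof.
apply: bounded_closed_compact.
  by exists M; split; [exact: num_real|move=> N MN x /= xM; apply: le_trans xM (ltW MN)].
apply: (preimage_closed (f := fun x : 'rV[R]_n => `|x|) (D := [set t | t <= M])).
  by move=> x _; apply: norm_continuous.
exact: closed_le.
Qed.

End RowVectors.

Definition simplex (R : realType) n : set 'rV[R]_n :=
  [set t | (forall i, 0 <= t ord0 i) /\ \sum_i t ord0 i = 1].

Lemma eq_of_ler_sum (R : numDomainType) (I : finType) (F G : I -> R) :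
  (forall i, F i <= G i) -> \sum_i F i = \sum_i G i -> forall i, F i = G i.
Proof.
move=> FG sFG i; apply/eqP; rewrite eq_le FG /= -subr_le0.
have : \sum_i (G i - F i) = 0 by rewrite sumrB sFG subrr.
have GF j : 0 <= G j - F j by rewrite subr_ge0.
rewrite (bigD1 i) //= => e; rewrite -[leRHS]e lerDl.
by apply: sumr_ge0.
Qed.

Section Brouwer.
Context {R : realType}.

(** Each grid point is coloured by a coordinate that f does not decrease; there is one because the
    coordinates before and after f both add up to 1. *)
Lemma simplex_almost_fixed n (f : 'rV[R]_n.+1 -> 'rV[R]_n.+1) (N : nat) :
  (forall t, simplex t -> simplex (f t)) ->
  exists2 x, simplex x & forall i, x ord0 i <= n%:R / N.+1%:R \/
    exists y, [/\ simplex y, y ord0 i <= f y ord0 i & `|x - y| <= n%:R / N.+1%:R].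
Proof.
move=> fs; have N0 : 0 < N.+1%:R :> R by rewrite ltr0n.
pose pt (t : {ffun 'I_n.+1 -> 'I_N.+2}) : 'rV[R]_n.+1 := \row_i ((t i)%:R / N.+1%:R).
have pt_simplex (t : {ffun 'I_n.+1 -> 'I_N.+2}) : (\sum_i t i = N.+1)%N -> simplex (pt t).
  move=> st; split=> [i|]; first by rewrite mxE divr_ge0.
  under eq_bigr do rewrite mxE.
  by rewrite -mulr_suml -natr_sum st divff // gt_eqF.
have colour (t : {ffun 'I_n.+1 -> 'I_N.+2}) : (\sum_i t i = N.+1)%N -> exists i, pt t ord0 i <= f (pt t) ord0 i.
  move=> /pt_simplex ts; apply: contrapT => /forallNP H.
  have lt i : f (pt t) ord0 i < pt t ord0 i by rewrite ltNge; apply/negP.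
  have [_ s1] := ts; have [_ s2] := fs _ ts.
  have := eq_of_ler_sum (fun i => ltW (lt i)) (etrans s2 (esym s1)) ord0.
  by move=> e; have := lt ord0; rewrite e ltxx.
pose c t := [pick i | pt t ord0 i <= f (pt t) ord0 i].
have [x sx xP] := scarf_grid (fun t => odflt ord0 (c t)).
exists (pt x); [exact: pt_simplex|move=> i; have [xi|[y sy [ci xy]]] := xP i].
  by left; rewrite mxE ler_pM2r ?invr_gt0 // ler_nat.
right; exists (pt y); split; [exact: pt_simplex| |].
  move: ci; rewrite /c; case: pickP => [j yj <- //|none].
  by have [j yj] := colour y sy; rewrite none in yj.
apply/row_norm_leP => [|j]; first by rewrite divr_ge0 // ltW.
rewrite !mxE -mulrBl normrM [X in _ * X]gtr0_norm ?invr_gt0 // ler_pM2r ?invr_gt0 //.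
have /andP[] := xy j; rewrite -!(ler_nat R) !natrD => h1 h2.
by rewrite ler_norml; apply/andP; split; lra.
Qed.

(** At a cluster point of the almost fixed points f decreases no coordinate, and equal sums then
    force equality. *)
Lemma brouwer_simplex n (f : 'rV[R]_n.+1 -> 'rV[R]_n.+1) :
  continuous f -> (forall t, simplex t -> simplex (f t)) ->
  exists2 t, simplex t & f t = t.
Proof.
move=> fc fs.
have /choice[x xP] : forall N, exists x, simplex x /\ forall i, x ord0 i <= n%:R / N.+1%:R \/
    exists y, [/\ simplex y, y ord0 i <= f y ord0 i & `|x - y| <= n%:R / N.+1%:R].
  by move=> N; have [x] := simplex_almost_fixed N fs; exists x.
have simplexP : closed (@simplex R n.+1).
  rewrite (_ : @simplex R n.+1 = \bigcap_i [set t | 0 <= t ord0 i] `&`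
      [set t | \sum_i t ord0 i = 1]); last first.
    by apply/seteqP; split=> t [h ?]; split=> // i; [move=> _|]; apply: h.
  apply: closedI.
    apply: closed_bigI => i _.
    apply: (preimage_closed (f := fun t : 'rV[R]_n.+1 => t ord0 i)
      (D := [set a | 0 <= a])) => [t _|]; first exact: coord_continuous.
    exact: closed_ge.
  apply: (preimage_closed (f := fun t : 'rV[R]_n.+1 => \sum_i t ord0 i)
      (D := [set a | a = 1])) => [t _|]; last exact: closed_eq.
  by apply: (@continuous_sum R) => i _; apply: coord_continuous.
have simplex_compact : compact (@simplex R n.+1).
  apply: (@subclosed_compact _ _ [set t : 'rV[R]_n.+1 | `|t| <= 1] simplexP).
    exact: compact_ball0.
  move=> t [t0 t1] /=.
  apply/row_norm_leP => // i; rewrite ger0_norm //.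
  by rewrite -t1 (bigD1 i) //= lerDl sumr_ge0.
have [p [ps px]] : @simplex R n.+1 `&` cluster (x @ \oo) !=set0.
  by apply: simplex_compact; exists 0%N => // N _ /=; case: (xP N).
exists p => //.
suff pf i : p ord0 i <= f p ord0 i.
  have [_ s1] := ps; have [_ s2] := fs _ ps.
  by apply/rowP => i; rewrite (eq_of_ler_sum pf) // s1 s2.
rewrite leNgt; apply/negP => fpi.
have [e e0 He] : exists2 e : R, 0 < e & forall y, `|p - y| < e -> f y ord0 i < y ord0 i.
  have : continuous (fun y : 'rV[R]_n.+1 => y ord0 i - f y ord0 i).
    move=> y; apply: (@continuousB _ _ _ (fun y : 'rV[R]_n.+1 => y ord0 i)).
      exact: coord_continuous.
    exact: continuous_coord.
  move=> /(_ p)/cvgr_gt/(_ 0); rewrite subr_gt0 => /(_ fpi).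
  move=> /nbhs_ballP[e /= e0 He]; exists e => // y py.
  by rewrite -subr_gt0; apply: He; rewrite -ball_normE.
have pi0 : 0 < p ord0 i.
  by apply: le_lt_trans fpi; case: (fs _ ps).
(* [p ord0 i / 2] excludes the alternative of a small i-th coordinate, and [e / 2] keeps y within e
   of p. *)
have [d d0 [de dp]] : exists2 d : R, 0 < d & d <= e / 2 /\ d <= p ord0 i / 2.
  exists (Num.min (e / 2) (p ord0 i / 2)); first by rewrite lt_min !divr_gt0.
  by rewrite !ge_min !lexx orbT.
have [N0 _ HN0] : \forall N \near \oo, n%:R / N.+1%:R < d.
  have : (fun N => n%:R * harmonic N) @ \oo --> n%:R * (0 : R).
    by apply: cvgMr; apply: cvg_harmonic.
  by rewrite mulr0 => /cvgr_lt; apply.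
have [_ [[N /= NN0 <-] xpd]] :
    [set x N | N in [set N | (N0 <= N)%N]] `&` ball p d !=set0.
  apply: px; last exact: nbhsx_ballx.
  by exists N0 => // N N0N; exists N.
move: xpd; rewrite -ball_normE /= => xpd; have Nd := HN0 _ NN0.
have [_ /(_ i)[xi|[y [_ yi xy]]]] := xP N.
  have /ltr_distlDr : `|p ord0 i - x N ord0 i| < d.
    by have := coord_le_norm (p - x N) i; rewrite !mxE => /le_lt_trans; apply.
  by have := le_lt_trans xi Nd; lra.
have : `|p - y| < e.
  rewrite -(subrKA (x N)) (le_lt_trans (ler_normD _ _)) //.
  by apply: lt_le_trans (ltrD xpd (le_lt_trans xy Nd)) _; lra.
by move/He; rewrite ltNge yi.
Qed.

Theorem brouwer n (f : 'rV[R]_n -> 'rV[R]_n) (M : R) :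
  continuous f -> (forall x, `|f x| <= M) -> exists x, f x = x.
Proof.
move=> fc fM0.
wlog M0 : M fM0 / 0 < M.
  apply; first by move=> x; apply: le_trans (fM0 x) (_ : _ <= `|M| + 1);
    rewrite ler_wpDr // ler_norm.
  by rewrite ltr_pwDr.
(* Coordinates of f plus M lie between 0 and 2M; division by [L] makes them at most 1/(n+1), so n of
   them leave a nonnegative coordinate 0. [phi] undoes this scaling. *)
pose L := 2 * M * n.+1%:R.
have L0 : 0 < L by rewrite !mulr_gt0.
pose phi (t : 'rV[R]_n.+1) : 'rV[R]_n := \row_i (L * t ord0 (lift ord0 i) - M).
pose h (t : 'rV[R]_n.+1) i : R := (f (phi t) ord0 i + M) / L.
pose g (t : 'rV[R]_n.+1) : 'rV[R]_n.+1 :=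
  \row_j if unlift ord0 j is Some i then h t i else 1 - \sum_i h t i.
have g0 t : g t ord0 ord0 = 1 - \sum_i h t i by rewrite mxE unlift_none.
have gS t i : g t ord0 (lift ord0 i) = h t i by rewrite mxE liftK.
have fM x i : - M <= f x ord0 i /\ f x ord0 i <= M.
  by apply/andP; rewrite -ler_norml (le_trans (coord_le_norm _ _)).
have h0 t i : 0 <= h t i.
  by rewrite divr_ge0 ?(ltW L0) //; have [] := fM (phi t) i; lra.
have h1 t i : h t i <= n.+1%:R^-1.
  rewrite ler_pdivrMr // /L mulrCA mulVf ?pnatr_eq0 // mulr1.
  by have [] := fM (phi t) i; lra.
have phic : continuous phi.
  apply: continuous_row => j.
  rewrite [X in continuous X](_ : _ = (fun t : 'rV[R]_n.+1 => L * t ord0 (lift ord0 j) - M)); last first.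
    by apply/funext => t; rewrite mxE.
  move=> t; apply: (@continuousB _ _ _ (fun t : 'rV[R]_n.+1 => L * t ord0 (lift ord0 j))).
    apply: (@continuousM _ _ (cst L)); first exact: cst_continuous.
    exact: coord_continuous.
  exact: cst_continuous.
have hc i : continuous (h^~ i).
  move=> t; apply: (@continuousM _ _ (fun t => f (phi t) ord0 i + M)); last exact: cst_continuous.
  apply: (@continuousD _ _ _ (fun t => f (phi t) ord0 i)); last exact: cst_continuous.
  apply: (@continuous_coord R n _ (f \o phi)) => {}t.
  by apply: continuous_comp; [apply: phic|apply: fc].
have [||t ts gt] := @brouwer_simplex n g.
- apply: continuous_row => j; have [i ->|->] := unliftP ord0 j.
    by rewrite [X in continuous X](_ : _ = h^~ i); [apply: hc|apply/funext => t; apply: gS].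
  rewrite [X in continuous X](_ : _ = (fun t : 'rV[R]_n.+1 => 1 - \sum_i h t i)); last first.
    by apply/funext.
  move=> t; apply: (@continuousB R R^o _ (fun=> 1) (fun t => \sum_i h t i)); first exact: cst_continuous.
  by apply: (@continuous_sum R) => i _.
- move=> t _; split=> [j|]; last first.
    by rewrite big_ord_recl g0 [X in _ + X](eq_bigr (h t)) ?subrK // => i _; apply: gS.
  have [i ->|->] := unliftP ord0 j; first by rewrite gS.
  rewrite g0 subr_ge0 (le_trans (ler_sum _ (fun i _ => h1 t i))) //.
  rewrite sumr_const card_ord -[X in X <= _]mulr_natl ler_pdivrMr ?ltr0n // mul1r ler_nat.
  exact: leqnSn.
exists (phi t); apply/rowP => i.
rewrite [RHS]mxE -[in RHS]gt gS /h mulrCA divff ?gt_eqF // mulr1.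
by rewrite addrK.
Qed.

End Brouwer.

(** * Continuous selections and fixed points of set-valued maps *)

Section Selections.
Context {R : realType}.

(** Made for partitions of unity: the weights are normalised by their sum, and points of weight 0
    may lie outside E. *)
Lemma convex_combination (V : lmodType R) (E : set V) (I : eqType) (s : seq I)
    (w : I -> R) (v : I -> V) :
  convex_set E -> (forall i, 0 <= w i) -> (forall i, 0 < w i -> E (v i)) ->
  0 < \sum_(i <- s) w i ->
  E ((\sum_(i <- s) w i)^-1 *: \sum_(i <- s) w i *: v i).
Proof.
move=> cE w0 wE; elim: s => [|i s IH]; first by rewrite big_nil ltxx.
rewrite !big_cons; set W := \sum_(j <- s) w j; set S := \sum_(j <- s) _.
have W0 : 0 <= W by apply: sumr_ge0.
move: W0; rewrite le_eqVlt => /predU1P[W0|W0].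
  have -> : S = 0.
    move/eqP: W0; rewrite eq_sym psumr_eq0 // => /allP s0.
    by rewrite /S big1_seq // => j /andP[_ /s0/eqP->]; rewrite scale0r.
  rewrite -W0 !addr0 => wi; rewrite scalerA mulVf ?gt_eqF // scale1r; exact: wE.
have := w0 i; rewrite le_eqVlt => /predU1P[<-|wi _].
  by rewrite add0r scale0r add0r.
have wW : 0 < w i + W by rewrite addr_gt0.
have t0 : 0 <= w i / (w i + W) by rewrite divr_ge0 // ltW.
have t1 : w i / (w i + W) <= 1 by rewrite ler_pdivrMr // mul1r lerDl ltW.
have /convex_setP/(_ _ _ _ t0 t1 (wE _ wi) (IH W0)) := cE.
congr E; rewrite scalerDr !scalerA; congr (_ *: _ + _ *: _); first by rewrite mulrC.
by rewrite -/W; field; rewrite !gt_eqF.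
Qed.

Lemma geometric_limit (T : topologicalType) n (f : nat -> T -> 'rV[R]_n) (M : R) :
  (forall k, continuous (f k)) ->
  (forall k t, `|f k.+1 t - f k t| <= M * 2^-1 ^+ k) ->
  exists2 g, continuous g & forall t, f ^~ t @ \oo --> g t.
Proof.
move=> fc fM; pose u k : R := M * 2^-1 ^+ k.
have u0 : u @ \oo --> (0 : R).
  rewrite -(mulr0 M); apply: cvgMr; apply: cvg_expr.
  by rewrite gtr0_norm ?invr_gt0 // invf_lt1 // ltr1n.
(* The subtracted term makes the induction on j close; [fu'] then drops it. *)
have fu k j t : `|f (k + j)%N t - f k t| <= 2 * (u k - u (k + j)%N).
  elim: j => [|j IH]; first by rewrite addn0 !subrr normr0 mulr0.
  rewrite addnS -(subrKA (f (k + j)%N t)) (le_trans (ler_normD _ _)) //.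
  apply: le_trans (lerD (fM _ _) IH) _.
  have -> : u (k + j).+1 = u (k + j)%N / 2 by rewrite /u exprSr mulrA.
  rewrite -/(u (k + j)%N); lra.
have uge0 (t : T) k : 0 <= u k.
  exact: le_trans (normr_ge0 _) (fM k t).
have fu' k j t : `|f (k + j)%N t - f k t| <= 2 * u k.
  apply: le_trans (fu k j t) _; have := uge0 t (k + j)%N; lra.
have cf t : cvg (f ^~ t @ \oo).
  apply: cauchy_cvg; apply: cauchy_exP => e e0.
  have : \forall k \near \oo, 2 * u k < e.
    have : (fun k => 2 * u k) @ \oo --> 2 * (0 : R) by apply: cvgMr.
    by rewrite mulr0 => /cvgr_lt; apply.
  move=> [k _ /(_ k (leqnn k)) uk]; exists (f k t); exists k => // m /= km.
  rewrite -ball_normE /= distrC -(subnKC km).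
  exact: le_lt_trans (fu' _ _ _) uk.
pose g t := lim (f ^~ t @ \oo).
have fg t : f ^~ t @ \oo --> g t := cf t.
exists g => // t.
have gu k s : `|g s - f k s| <= 2 * u k.
  apply: (@ler_cvg_to _ \oo _ _ (fun m => `|f m s - f k s|) (cst (2 * u k))).
  - by apply: cvg_norm; apply: cvgB; [apply: fg|apply: cvg_cst].
  - exact: cvg_cst.
  - by exists k => // m /= km; rewrite -(subnKC km).
apply/cvgrPdist_lt => e e0.
have [k _ /(_ k (leqnn k)) uk] : \forall k \near \oo, 2 * u k < e / 3.
  have : (fun k => 2 * u k) @ \oo --> 2 * (0 : R) by apply: cvgMr.
  by rewrite mulr0 => /cvgr_lt; apply; rewrite divr_gt0.
have e3 : 0 < e / 3 by rewrite divr_gt0.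
have /cvgrPdist_lt/(_ _ e3) := fc k t.
apply: filterS => s ts.
have -> : g t - g s = (g t - f k t) + (f k t - f k s) + (f k s - g s).
  by rewrite !addrA subrK subrK.
apply: le_lt_trans (ler_normD _ _) _; have := ler_normD (g t - f k t) (f k t - f k s).
have := gu k t; have := gu k s; rewrite (distrC (g s)) => h1 h2 h3.
by apply: le_lt_trans (lerD (le_trans h3 (lerD h2 (ltW ts))) h1) _; lra.
Qed.

End Selections.

(** The metric form of lower semicontinuity; [lsc_on_lsc] derives it from the form with nets. *)
Definition lsc (T : topologicalType) (R : realType) (V : normedModType R)
    (H : T -> set V) : Prop :=
  forall t y (e : R), 0 < e -> H t y ->
    \forall s \near t, exists2 z, H s z & `|y - z| < e.

Lemma norm_conv_lt (R : realType) (V : normedModType R) (x y : V) (t e : R) :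
  0 <= t -> t <= 1 -> `|x| < e -> `|y| < e -> `|t *: x + (1 - t) *: y| < e.
Proof.
move=> t0 t1 xe ye; apply: le_lt_trans (ler_normD _ _) _.
rewrite !normrZ (ger0_norm t0) (@ger0_norm _ (1 - t)) ?subr_ge0 //.
move: t0; rewrite le_eqVlt => /predU1P[<-|t0]; first by rewrite mul0r add0r subr0 mul1r.
have -> : e = t * e + (1 - t) * e by ring.
by rewrite ltr_leD ?ltr_pM2l // ler_wpM2l ?subr_ge0 // ltW.
Qed.

Lemma convex_norm_lt (R : realType) (V : normedModType R) (a : V) (e : R) :
  convex_set [set y | `|y - a| < e].
Proof.
apply/convex_setP => x y t t0 t1 /= xa ya.
have := norm_conv_lt t0 t1 xa ya; congr (`|_| < e).
by rewrite !scalerBr addrACA -opprD -scalerDl [t + _]addrC subrK scale1r.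
Qed.

Section Selections.
Context {R : realType} {n : nat}.
Let V := 'rV[R]_n.

Variables (A : set V) (c : V -> V).
Hypothesis A_compact : compact A.
Hypothesis c_continuous : continuous c.
Hypothesis c_in : forall z, A (c z).
Hypothesis c_id : forall z, A z -> c z = z.

(** Partition of unity over finitely many balls, on each of which a fixed vector is e-close to [H];
    convexity keeps the weighted mean e-close. The total weight may vanish off [A], hence the
    composition with the retraction [c]. *)
Lemma approximate_selection (H : V -> set V) (e : R) :
  lsc H -> (forall z, A z -> H z !=set0) -> (forall z, A z -> convex_set (H z)) ->
  0 < e ->
  exists2 g : V -> V, continuous g &
    forall z, A z -> exists2 y, H z y & `|y - g z| < e.
Proof.
move=> lH H0 cH e0.
have /choice[F FP] : forall z : V, exists q : V * R,
    (A z -> 0 < q.2) /\ forall s, `|z - s| < q.2 -> exists2 y, H s y & `|q.1 - y| < e.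
  move=> z; have [Az|nAz] := pselect (A z); last first.
    (* Outside [A] the radius 0 makes the closeness condition vacuous. *)
    by exists (0, 0); split=> // s; rewrite /= ltNge normr_ge0.
  have [y Hy] := H0 z Az; have /nbhs_ballP[r /= r0 rP] := lH z y e e0 Hy.
  by exists (y, r); split=> // s zs; apply: rP; rewrite -ball_normE.
have [D _ cover] : finite_subset_cover A (fun z => ball z (F z).2) A.
  move: A_compact; rewrite compact_cover; apply.
    by move=> z Az; apply: ball_open; case: (FP z) => + _; apply.
  by move=> z Az; exists z => //; apply: ballxx; case: (FP z) => + _; apply.
pose b (i z : V) : R := (F i).2 - `|i - z|.
(* Twice the positive part of [b i z]: a continuous weight, positive exactly on the ball of centre i
   and radius [(F i).2]. *)
pose w (i z : V) : R := `|b i z| + b i z.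
have w0 i z : 0 <= w i z by have := ler_norm (- b i z); rewrite normrN /w; lra.
have wpos i z : 0 < w i z -> `|i - z| < (F i).2.
  move=> w_gt0; rewrite -subr_gt0 -/(b i z) ltNge; apply/negP => b0.
  by move: w_gt0; rewrite /w ler0_norm // addNr ltxx.
have W0 z : A z -> 0 < \sum_(i <- D) w i z.
  move=> /cover[i /= iD]; rewrite -ball_normE /= -subr_gt0 -/(b i z) => bi.
  rewrite (big_rem i) //= ltr_pwDl ?sumr_ge0 // /w gtr0_norm // addr_gt0 //.
have wc i : continuous (w i).
  have bc : continuous (b i).
    move=> z; apply: (@continuousB R R^o _ (cst (F i).2) (fun z : V => `|i - z|)); first exact: cst_continuous.
    apply: (@continuous_comp _ _ _ (fun z : V => i - z) (fun z => `|z|)); last exact: norm_continuous.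
    by apply: (@continuousB R V V (cst i) id); [apply: cst_continuous|].
  move=> z; apply: (@continuousD R R^o _ (fun z => `|b i z|) (b i)); last exact: bc.
  by apply: continuous_comp; [apply: bc|apply: norm_continuous].
pose g0 z : V := (\sum_(i <- D) w i z)^-1 *: \sum_(i <- D) w i z *: (F i).1.
exists (g0 \o c) => [z|z Az /=].
  apply: continuous_comp; first exact: c_continuous.
  apply: continuousZ; last first.
    by apply: continuous_sum => i _ t; apply: continuousZl; apply: wc.
  apply: continuousV; first by rewrite gt_eqF // W0.
  by apply: (@continuous_sum R _ R^o) => i _; apply: wc.
rewrite c_id //.
have : [set v : V | exists2 y, H z y & `|y - v| < e] (g0 z).
  apply: convex_combination => //=.
  - apply/convex_setP => x y t t0 t1 [x' Hx' xx'] [y' Hy' yy'].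
    exists (t *: x' + (1 - t) *: y').
      by have /convex_setP := cH z Az; apply.
    by rewrite opprD addrACA -!scalerBr norm_conv_lt.
  - move=> i /wpos iz; have [_ /(_ _ iz)[y Hy iy]] := FP i.
    by exists y; rewrite // distrC.
  - exact: W0.
by case=> y Hy yg; exists y.
Qed.

(** Michael's iteration: the next approximate selection is taken in the part of [H] within [r k] of
    the current one, so the steps decrease geometrically and the limit is at distance 0 from the
    values. *)
Lemma closure_selection (H : V -> set V) :
  lsc H -> (forall z, A z -> H z !=set0) -> (forall z, A z -> convex_set (H z)) ->
  exists2 f : V -> V, continuous f & forall z, closure (H (c z)) (f z).
Proof.
move=> lH H0 cH; pose r k : R := 2^-1 ^+ k.
have r0 k : 0 < r k by rewrite exprn_gt0 // invr_gt0.
pose P k (g : V -> V) := continuous g /\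
  forall z, A z -> exists2 y, H z y & `|y - g z| < r k.
have step k g : P k g ->
    exists2 g', P k.+1 g' & forall z, A z -> `|g' z - g z| <= 2 * r k.
  move=> [gc gH]; pose H' z := H z `&` [set y | `|y - g z| < r k].
  have lH' : lsc H'.
    move=> t y e e0 [Hy yg]; pose d := (r k - `|y - g t|) / 2.
    have d0 : 0 < d by rewrite divr_gt0 // subr_gt0.
    have ed0 : 0 < Num.min e d by rewrite lt_min e0.
    have := lH t y _ ed0 Hy; have /cvgrPdist_lt/(_ _ d0) := gc t.
    apply: filterS2 => s gts [z Hz]; rewrite lt_min => /andP[yz yz'].
    exists z => //; split=> //=.
    have -> : z - g s = (z - y) + (y - g t) + (g t - g s) by rewrite !subrKA.
    apply: le_lt_trans (ler_normD _ _) _.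
    apply: lt_le_trans (_ : d + `|y - g t| + d <= _); last by rewrite /d; lra.
    apply: ltrD => //; apply: le_lt_trans (ler_normD _ _) _.
    by rewrite ltrD2r distrC.
  have H'0 z : A z -> H' z !=set0 by move=> /gH[y Hy yg]; exists y.
  have cH' z : A z -> convex_set (H' z).
    move=> Az; apply/convex_setP => x y t t0 t1 [Hx xg] [Hy yg]; split.
      by have /convex_setP := cH z Az; apply.
    by have /convex_setP := @convex_norm_lt R V (g z) (r k); apply.
  have [g' g'c g'H] := approximate_selection lH' H'0 cH' (r0 k.+1).
  exists g'; first by split=> // z /g'H[y [Hy _] yg]; exists y.
  move=> z /g'H[y [_ /= yg] yg'].
  rewrite -(subrKA y) (le_trans (ler_normD _ _)) // distrC.
  apply: le_trans (lerD (ltW yg') (ltW yg)) _.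
  have -> : r k.+1 = r k / 2 by rewrite /r exprSr.
  by have := r0 k; lra.
have [g0 g0c g0H] := approximate_selection lH H0 cH (r0 0%N).
have /choice[F FP] : forall q : nat * (V -> V), exists g', P q.1 q.2 ->
    P q.1.+1 g' /\ forall z, A z -> `|g' z - q.2 z| <= 2 * r q.1.
  move=> q; have [/step[g' Pg' gg']|nP] := pselect (P q.1 q.2); first by exists g'.
  by exists q.2.
pose fix G k := if k is k'.+1 then F (k', G k') else g0.
have PG k : P k (G k) by elim: k => [//|k /(FP (k, _))[]].
have GG k z : A z -> `|G k.+1 z - G k z| <= 2 * r k.
  by have [_] := FP (k, G k) (PG k); apply.
have [||f fc Gf] := @geometric_limit R V n (fun k => G k \o c) 2.
- move=> k z; apply: continuous_comp; first exact: c_continuous.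
  by case: (PG k) => + _; apply.
- by move=> k z; apply: GG.
exists f => // z B /nbhs_ballP[e /= e0 eB].
have e2 : 0 < e / 2 by rewrite divr_gt0.
have h1 : \forall k \near \oo, r k < e / 2.
  have : r @ \oo --> (0 : R).
    by apply: cvg_expr; rewrite gtr0_norm ?invr_gt0 // invf_lt1 // ltr1n.
  by move/cvgr_lt; apply.
have /cvgrPdist_lt/(_ _ e2) h2 := Gf z.
have [k [rk fk]] := filter_ex (filterI h1 h2).
have [_ /(_ _ (c_in z))[y Hy yG]] := PG k.
exists y; split=> //; apply: eB; rewrite -ball_normE /=.
rewrite -(subrKA (G k (c z))) (le_lt_trans (ler_normD _ _)) //.
have -> : e = e / 2 + e / 2 by field.
by rewrite ltrD // distrC (lt_trans yG).
Qed.

End Selections.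

(** * Fixed points of lower semicontinuous maps with convex values *)

Section FixedPoint.
Context {R : realType} {n : nat}.
Let V := 'rV[R]_n.

Lemma ball_retraction (K : R) : 0 < K -> exists c : V -> V,
  [/\ continuous c, forall z, `|c z| <= K & forall z, `|z| <= K -> c z = z].
Proof.
move=> K0; pose m (z : V) : R := (K + `|z| + `|K - `|z| |) / 2.
have zm z : `|z| <= m z.
  by have := ler_norm (`|z| - K); rewrite distrC /m; lra.
have mK z : `|z| <= K -> m z = K.
  by move=> zK; rewrite /m ger0_norm ?subr_ge0 //; lra.
have m0 z : 0 < m z.
  by have := ler_norm (K - `|z|); have := normr_ge0 z; rewrite /m; lra.
exists (fun z => (K / m z) *: z); split=> [z|z|z zK]; last first.
- by rewrite mK // divff ?gt_eqF // scale1r.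
- rewrite normrZ ger0_norm; last by rewrite divr_ge0 // ltW.
  by rewrite mulrAC ler_pdivrMr // ler_wpM2l // ltW.
have nc : continuous (fun z : V => `|z|) by move=> x; apply: norm_continuous.
have nKc : continuous (fun z : V => `|K - `|z| |).
  move=> x; apply: (@continuous_comp _ _ _ (fun z : V => K - `|z|) (fun t : R => `|t|)).
    by apply: (@continuousB R R^o _ (cst K) (fun z : V => `|z|)); [apply: cst_continuous|apply: nc].
  exact: norm_continuous.
have mc : continuous m.
  move=> x; apply: (@continuousM _ _ (fun z : V => K + `|z| + `|K - `|z| |) (cst 2^-1));
    last exact: cst_continuous.
  apply: (@continuousD R R^o _ (fun z : V => K + `|z|)); last exact: nKc.
  by apply: (@continuousD R R^o _ (cst K)); [apply: cst_continuous|apply: nc].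
apply: (@continuousZ R V _ (fun z => K / m z) id); last exact: cvg_id.
apply: (@continuousM _ _ (cst K) (fun z => (m z)^-1)); first exact: cst_continuous.
by apply: continuousV; [rewrite gt_eqF|apply: mc].
Qed.

Lemma dot_continuous (p : V) : continuous (dot p).
Proof.
apply: (@continuous_sum R _ R^o) => i _ y.
by apply: (@continuousM _ _ (cst (p ord0 i))); [apply: cst_continuous|apply: coord_continuous].
Qed.

Lemma rational_approx (y : V) (e : R) : 0 < e ->
  exists q : 'rV[rat]_n, `|y - map_mx ratr q| < e.
Proof.
move=> e0; have /choice[q qP] : forall i, exists q : rat, `|y ord0 i - ratr q| < e.
  move=> i; have [|q] := @rat_in_itvoo _ (y ord0 i - e) (y ord0 i + e); first by lra.
  by rewrite in_itv /= => h; exists q; rewrite ltr_distlC.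
by exists (\row_i q i); apply/row_norm_ltP => // i; rewrite !mxE.
Qed.

Lemma closure_dot_ge (p : V) (a : R) (S : set V) :
  (forall y, S y -> a <= dot p y) -> forall y, closure S y -> a <= dot p y.
Proof.
move=> Sp; have Pc : closed [set y : V | a <= dot p y].
  by apply: (preimage_closed (f := dot p) (D := [set t | a <= t])) => [x _|];
    [apply: dot_continuous|apply: closed_ge].
move=> y Sy; apply: Pc; move: y Sy; exact: closureS.
Qed.

Lemma closure_norm_le (q : V) (r : R) (S : set V) :
  (forall y, S y -> `|y - q| <= r) -> forall y, closure S y -> `|y - q| <= r.
Proof.
move=> Sp; have Pc : closed [set y : V | `|y - q| <= r].
  apply: (preimage_closed (f := fun y : V => `|y - q|) (D := [set t | t <= r]));
    last exact: closed_le.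
  move=> x _; apply: (@continuous_comp _ _ _ (fun y : V => y - q) (fun y => `|y|)).
    by apply: (@continuousB R V V id (cst q)); [apply: cvg_id|apply: cst_continuous].
  exact: norm_continuous.
move=> y Sy; apply: Pc; move: y Sy; exact: closureS.
Qed.

(* The values of [H] need not be closed, so continuous selections of the closure
   of [H] are not enough.  A weighted sum of countably many of them, dense enough
   in every [H z], avoids the relative boundary of [H z]. *)
Theorem lsc_fixed_point (H : V -> set V) (M : R) :
  lsc H -> (forall z, H z !=set0) -> (forall z, convex_set (H z)) ->
  (forall z y, H z y -> `|y| <= M) -> exists z, H z z.
Proof.
move=> lH H0 cH HM.
have M0 : 0 <= M by have [y /HM] := H0 0; apply: le_trans.
(* M may be 0, while the retraction needs a positive radius. *)
have K0 : 0 < M + 1 by lra.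
have [c [cc cK cid]] := ball_retraction K0.
pose r (a : nat) : R := a.+1%:R^-1.
have r0 a : 0 < r a by rewrite invr_gt0 ltr0n.
(* [U q a] is open by lower semicontinuity, hence the union over m of the closed sets [B q a m].
   Closedness keeps [Hq] lower semicontinuous when [H] is cut down to a rational ball over
   [B q a m]. *)
pose U (q : 'rV[rat]_n) a : set V := [set z | exists2 y, H z y & `|y - map_mx ratr q| < r a].
pose B q a m := closure [set z : V | ball z (r m) `<=` U q a].
have BU q a m z : B q a m z -> U q a z.
  move=> /(_ (ball z (r m)) (nbhsx_ballx _ _ (r0 m)))[s [sU zs]].
  by apply: sU; apply: ball_sym.
pose Hq q a m z := if pselect (B q a m z) then H z `&` [set y | `|y - map_mx ratr q| < r a]
                   else H z.
have HqE q a m z : B q a m z -> Hq q a m z = H z `&` [set y | `|y - map_mx ratr q| < r a].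
  by rewrite /Hq; case: pselect.
have HqF q a m z : ~ B q a m z -> Hq q a m z = H z by rewrite /Hq; case: pselect.
have HqH q a m z : Hq q a m z `<=` H z.
  by have [/HqE->|/HqF->] := pselect (B q a m z); [move=> y []|].
have lHq q a m : lsc (Hq q a m).
  move=> t y e e0; have [/HqE->|nBt] := pselect (B q a m t).
    move=> [Hy /= yq]; pose d := Num.min e (r a - `|y - map_mx ratr q|).
    have d0 : 0 < d by rewrite lt_min e0 subr_gt0.
    apply: filterS (lH t y d d0 Hy) => s [z Hz]; rewrite lt_min => /andP[yz yz'].
    exists z => //; have [/HqE->|/HqF->//] := pselect (B q a m s); split=> //=.
    by rewrite -(subrKA y) (le_lt_trans (ler_normD _ _)) // distrC -ltrBrDr.
  rewrite HqF // => Hy; have : \forall s \near t, ~ B q a m s.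
    apply: open_nbhs_nbhs; split=> //.
    by apply: closed_openC; apply: closed_closure.
  apply: filterS2 (lH t y e e0 Hy) => s [z Hz yz] nBs.
  by exists z; rewrite // HqF.
have Hq0 q a m z : Hq q a m z !=set0.
  have [Bz|/HqF->//] := pselect (B q a m z).
  by rewrite HqE //; have [y Hy yq] := BU _ _ _ _ Bz; exists y.
have cHq q a m z : convex_set (Hq q a m z).
  have [/HqE->|/HqF->//] := pselect (B q a m z).
  apply/convex_setP => x y t t0 t1 [Hx xq] [Hy yq]; split.
    by have /convex_setP := cH z; apply.
  by have /convex_setP := @convex_norm_lt R V (map_mx ratr q) (r a); apply.
(* Codes of no triple fall back on [H]. *)
pose Hj j z := if @unpickle ('rV[rat]_n * nat * nat)%type j is Some (q, a, m)
               then Hq q a m z else H z.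
have HjH j z : Hj j z `<=` H z.
  by rewrite /Hj; case: unpickle => [[[q a] m]|].
have /choice[f fP] : forall j, exists f : V -> V,
    continuous f /\ forall z, closure (Hj j (c z)) (f z).
  move=> j; have [||||||f fc fH] := @closure_selection R n [set z | `|z| <= M + 1] c _ cc _ _ (Hj j).
  - exact: compact_ball0.
  - exact: cK.
  - exact: cid.
  - by rewrite /Hj; case: unpickle => [[[q a] m]|].
  - by move=> z _; rewrite /Hj; case: unpickle => [[[q a] m]|].
  - by move=> z _; rewrite /Hj; case: unpickle => [[[q a] m]|].
  - by exists f.
have fM j z : `|f j z| <= M.
  have [_ /(_ z) fz] := fP j; rewrite -[f j z]subr0.
  move: fz; apply: closure_norm_le => y /HjH.
  by rewrite subr0; apply: HM.
(* These weights add up to [1 - 2^-1 ^+ k], the factor that recurs in [wM] and [D]. *)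
pose w k z : V := \sum_(j < k) 2^-1 ^+ j.+1 *: f j z.
have wS k z : w k.+1 z = w k z + 2^-1 ^+ k.+1 *: f k z by rewrite /w big_ord_recr.
have half0 k : 0 <= 2^-1 ^+ k :> R by rewrite exprn_ge0 // invr_ge0.
have wM k z : `|w k z| <= (1 - 2^-1 ^+ k) * M.
  elim: k => [|k IH]; first by rewrite /w big_ord0 normr0 subrr mul0r.
  rewrite wS (le_trans (ler_normD _ _)) // normrZ ger0_norm //.
  apply: le_trans (lerD IH (ler_wpM2l (half0 _) (fM k z))) _.
  by rewrite exprS; lra.
have [||g gc wg] := @geometric_limit R V n w (2^-1 * M).
- move=> k; apply: continuous_sum => j _ z.
  by apply: (@continuousZr R V V (f j)); case: (fP j) => + _; apply.
- move=> k z; rewrite wS addrC addKr normrZ ger0_norm // mulrAC -exprS.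
  by rewrite ler_wpM2l.
have gM z : `|g z| <= M.
  apply: (@ler_cvg_to _ \oo _ _ (fun k => `|w k z|) (cst M)).
  - by apply: cvg_norm; apply: wg.
  - exact: cvg_cst.
  - by near=> k; apply: le_trans (wM k z) _; rewrite ler_piMl // lerBlDr lerDl.
have [z gz] := brouwer gc gM.
exists z; apply: contrapT => nHz.
have cz : c z = z by apply: cid; rewrite -gz; have := gM z; lra.
(* On [H z] the functional p is at least [dot p z], strictly so at some point. Every [f j z]
   inherits the weak inequality, and one aimed at a rational ball near that point the strict one,
   which prevents the weighted sum [g z] from being z. *)
have [|||p p0 [y]] := @proper_separation R n [set s | H z (s + z)].
- apply/convex_setP => x y t t0 t1 /= Hx Hy.
  have /convex_setP/(_ _ _ t t0 t1 Hx Hy) := cH z; congr (H z _).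
  by rewrite !scalerDr addrACA -scalerDl [t + _]addrC subrK scale1r.
- by have [y Hy] := H0 z; exists (y - z); rewrite /= subrK.
- by rewrite /= add0r.
rewrite /= => Hy py; set y' := y + z in Hy.
have {}py : dot p z < dot p y' by rewrite /y' dotDr ltrDr.
have pf j : dot p z <= dot p (f j z).
  have [_ /(_ z)] := fP j; rewrite cz; apply: closure_dot_ge => s /HjH Hs.
  by rewrite -subr_ge0 -dotBr; apply: p0; rewrite /= subrK.
have [e e0 eP] : exists2 e : R, 0 < e & forall v, `|y' - v| < e -> dot p z < dot p v.
  have := @dot_continuous p y'; move=> /cvgr_gt/(_ _ py)/nbhs_ballP[e /= e0 eP].
  by exists e => // v yv; apply: eP; rewrite -ball_normE.
have harm (t : R) : 0 < t -> exists a, r a < t.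
  move=> t0; have /cvgr_lt/(_ _ t0) := @cvg_harmonic R.
  by move=> [a _ /(_ a (leqnn a))]; exists a.
have [a ra] : exists a, r a < e / 2 by apply: harm; rewrite divr_gt0.
have [q yq] := rational_approx y' (r0 a).
have [m zB] : exists m, B q a m z.
  have d0 : 0 < r a - `|y' - map_mx ratr q| by rewrite subr_gt0.
  have /nbhs_ballP[d /= dpos dP] := lH z y' _ d0 Hy.
  have [m md] := harm d dpos; exists m; apply: subset_closure => s zs.
  have [v Hv yv] := dP s (le_ball (ltW md) zs); exists v => //.
  rewrite -(subrKA y') (le_lt_trans (ler_normD _ _)) // distrC; lra.
pose j := pickle (q, a, m).
have pfj : dot p z < dot p (f j z).
  apply: eP; rewrite -(subrKA (map_mx ratr q)) (le_lt_trans (ler_normD _ _)) //.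
  have : `|f j z - map_mx ratr q| <= r a.
    have [_ /(_ z)] := fP j; apply: closure_norm_le => v.
    by rewrite cz /Hj pickleK HqE // => -[_ /ltW].
  by rewrite distrC => h; have := ltrD yq (le_lt_trans h ra); lra.
(* [D k] accumulates the nonnegative contributions of the first k selections; it tends to 0 since
   [g z = z], yet beyond j it stays above the positive contribution of j. *)
pose D k := dot p (w k z) - (1 - 2^-1 ^+ k) * dot p z.
have DS k : D k.+1 = D k + 2^-1 ^+ k.+1 * (dot p (f k z) - dot p z).
  by rewrite /D wS dotDr dotZr exprS; field.
have D0 k : 0 <= D k.
  elim: k => [|k IH]; first by rewrite /D /w big_ord0 dot0r subrr mul0r subr0.
  by rewrite DS addr_ge0 // mulr_ge0 // subr_ge0.
have Dlim : D @ \oo --> dot p (g z) - (1 - 0) * dot p z.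
  apply: cvgB.
    by apply: (@cvg_comp _ _ _ (w ^~ z) (dot p) _ _ _ (wg z)); apply: dot_continuous.
  apply: cvgMl; apply: cvgB; first exact: cvg_cst.
  by apply: cvg_expr; rewrite gtr0_norm ?invr_gt0 // invf_lt1 // ltr1n.
have eta : 0 < 2^-1 ^+ j.+1 * (dot p (f j z) - dot p z).
  by rewrite mulr_gt0 ?subr_gt0 // exprn_gt0 // invr_gt0.
rewrite gz subr0 mul1r subrr in Dlim; move: eta; rewrite ltNge => /negP; apply.
apply: (@ler_cvg_to _ \oo _ _ (cst _) D _ _ (@cvg_cst _ _ _ _ _) Dlim).
exists j.+1 => // k /= jk; rewrite -(subnKC jk).
elim: (k - j.+1)%N => [|i IH]; first by rewrite addn0 DS lerDr.
by rewrite addnS DS (le_trans IH) // lerDl mulr_ge0 // subr_ge0.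
Unshelve. all: by end_near. Qed.

End FixedPoint.

(** * Metric projection *)

Section Projection.
Context {R : realType} {n : nat}.
Let V := 'rV[R]_n.

Lemma dot_ge0 (x : V) : 0 <= dot x x.
Proof. by apply: sumr_ge0 => i _; rewrite -expr2 sqr_ge0. Qed.

Lemma euclid_normE (x : V) : euclid_norm x = Num.sqrt (dot x x).
Proof. by rewrite /euclid_norm; congr Num.sqrt; apply: eq_bigr => i _; rewrite expr2. Qed.

Lemma sqr_norm_le_dot (x : V) : `|x| ^+ 2 <= dot x x.
Proof.
suff h : `|x| <= Num.sqrt (dot x x).
  by rewrite -(sqr_sqrtr (dot_ge0 x)) ler_sqr ?nnegrE ?sqrtr_ge0.
apply/row_norm_leP => [|i]; first exact: sqrtr_ge0.
rewrite -sqrtr_sqr ler_wsqrtr // /dot (bigD1 i) //= -expr2 lerDl.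
by apply: sumr_ge0 => j _; rewrite -expr2 sqr_ge0.
Qed.

Lemma dot_le_norm (x y : V) : dot x y <= n%:R * (`|x| * `|y|).
Proof.
apply: le_trans (_ : \sum_(i < n) `|x| * `|y| <= _); last first.
  by rewrite sumr_const card_ord mulr_natl.
apply: ler_sum => i _; apply: le_trans (ler_norm _) _.
by rewrite normrM ler_pM // coord_le_norm.
Qed.

Lemma metric_proj_nonempty (C : set V) (z : V) :
  C !=set0 -> closed C -> metric_proj C z !=set0.
Proof.
move=> [w0 Cw0] clC.
pose D := C `&` [set w | `|w - z| <= euclid_norm (z - w0)].
have normC w : `|w - z| <= euclid_norm (z - w).
  rewrite distrC euclid_normE -(ler_sqr (normr_ge0 _)) ?nnegrE ?sqrtr_ge0 //.
  by rewrite sqr_sqrtr ?dot_ge0 // sqr_norm_le_dot.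
have wc : continuous (fun w : V => w - z).
  by move=> w; apply: (@continuousB R V V id (cst z)); [apply: cvg_id|apply: cst_continuous].
have cD : compact D.
  apply: bounded_closed_compact; last first.
    apply: closedI => //.
    apply: (preimage_closed (f := fun w : V => `|w - z|) (D := [set t | t <= euclid_norm (z - w0)])).
      move=> w _; apply: (@continuous_comp _ _ _ (fun w : V => w - z) (fun y => `|y|)).
        exact: wc.
      exact: norm_continuous.
    exact: closed_le.
  exists (euclid_norm (z - w0) + `|z|); split; first exact: num_real.
  move=> N hN w [_ /= wz]; rewrite -(subrK z w) (le_trans (ler_normD _ _)) //.
  by apply: le_trans (ltW hN); rewrite lerD2r.
have dc : continuous (fun w : V => dot (z - w) (z - w)).
  apply: (@continuous_sum R _ R^o) => i _ w.
  have cc : {for w, continuous (fun w : V => (z - w) ord0 i)}.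
    apply: (@continuous_coord R n V (fun w => z - w)) => {}w.
    by apply: (@continuousB R V V (cst z) id); [apply: cst_continuous|apply: cvg_id].
  exact: (@continuousM _ _ (fun w : V => (z - w) ord0 i)).
have [||x xD xmin] := @EVT_min_rV R n (fun w => dot (z - w) (z - w)) D _ cD.
- by exists w0; split=> //=; apply: normC.
- exact: continuous_subspaceT.
move: xD; rewrite inE => -[Cx xz]; exists x; split=> // w Cw.
have [wz|wz] := leP (`|w - z|) (euclid_norm (z - w0)).
  by rewrite !euclid_normE ler_wsqrtr // xmin // inE.
have w0D : w0 \in D by rewrite inE; split=> //=; apply: normC.
apply: le_trans (le_trans (ltW wz) (normC w)).
by rewrite !euclid_normE ler_wsqrtr // xmin.
Qed.

(** First-order optimality of x along the segment from x to w. *)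
Lemma metric_proj_dot_le0 (C : set V) (z x w : V) :
  convex_set C -> metric_proj C z x -> C w -> dot (z - x) (w - x) <= 0.
Proof.
move=> cC [Cx xmin] Cw; set a := dot (z - x) (w - x); set b := dot (w - x) (w - x).
rewrite leNgt; apply/negP => a0.
have b0 : 0 <= b := dot_ge0 _.
have key t : 0 <= t -> t <= 1 -> 2 * t * a <= t ^+ 2 * b.
  move=> t0 t1; have /convex_setP/(_ w x t t0 t1 Cw Cx)/xmin := cC.
  rewrite !euclid_normE ler_sqrt ?dot_ge0 //.
  have -> : z - (t *: w + (1 - t) *: x) = (z - x) - t *: (w - x).
    by apply/rowP => i; rewrite !mxE; ring.
  move: (z - x) (w - x) @a @b {a0 b0} => u v a b.
  rewrite [leRHS]dotBr !dotBl !dotZl !dotZr (dotC v u) -/a -/b; lra.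
(* The natural choice [a / b] may exceed 1 or have a zero denominator; this one stays at most 1 and
   still contradicts [key]. *)
pose t := a / (a + b).
have ab : 0 < a + b by lra.
have t0 : 0 < t by rewrite divr_gt0.
have t1 : t <= 1 by rewrite ler_pdivrMr // mul1r lerDl.
have h : 2 * a <= t * b.
  rewrite -(ler_pM2l t0) (_ : t * (t * b) = t ^+ 2 * b); last by ring.
  by rewrite (_ : t * (2 * a) = 2 * t * a) ?key ?(ltW t0) //; ring.
have : t * b <= a by rewrite /t mulrAC ler_pdivrMr // ler_wpM2l; lra.
lra.
Qed.

(** Adding the variational inequalities at s and z bounds the squared Euclidean distance of the
    projections by [dot (s - z) (P s - P z)]; the sup norm turns this into a Lipschitz bound with
    constant n. *)
Lemma metric_proj_continuous (C : set V) :
  C !=set0 -> closed C -> convex_set C ->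
  exists2 P : V -> V, continuous P & forall z, metric_proj C z (P z).
Proof.
move=> C0 clC cC.
have /choice[P PP] := fun z => metric_proj_nonempty z C0 clC.
exists P => // z.
have lip s : `|P s - P z| <= n%:R * `|s - z|.
  have [<-|ne] := eqVneq (P s) (P z); first by rewrite subrr normr0 mulr_ge0.
  have ne0 : 0 < `|P s - P z| by rewrite normr_gt0 subr_eq0.
  rewrite -(ler_pM2r ne0) -expr2 -mulrA.
  apply: le_trans (sqr_norm_le_dot _) _; apply: le_trans (dot_le_norm _ _).
  have h1 := metric_proj_dot_le0 cC (PP s) (PP z).1.
  have h2 := metric_proj_dot_le0 cC (PP z) (PP s).1.
  move: h1 h2; rewrite !dotBl !dotBr; lra.
apply/(@cvgrPdist_lt _ _ _ (nbhs z)) => e e0.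
(* The divisor n + 1 covers dimension 0. *)
have e1 : 0 < e / n.+1%:R by rewrite divr_gt0.
apply/nbhs_ballP; exists (e / n.+1%:R) => // s; rewrite -ball_normE /= => zs.
rewrite distrC; apply: le_lt_trans (lip s) _; rewrite distrC.
apply: le_lt_trans (_ : n.+1%:R * `|z - s| < _); last by rewrite mulrC -ltr_pdivlMr.
by rewrite ler_wpM2r // ler_nat.
Qed.

End Projection.

(** If the metric form failed at z, some sequence tending to z would have all its values at distance
    at least e from y. Taken as a net over [nat], it contradicts the existence of a subnet with
    values tending to y. *)
Lemma lsc_on_lsc (R : realType) (U V : normedModType R) (X : topologicalType)
    (A : set X) (Phi : X -> set V) (h : U -> X) :
  lsc_on A Phi -> continuous h -> (forall z, A (h z)) ->
  lsc (fun z => Phi (h z)).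
Proof.
move=> lPhi hc hA z y e e0 Py; apply: contrapT => nlsc.
have /choice[x xP] : forall k : nat, exists s : U, `|z - s| < k.+1%:R^-1 /\
    forall v, Phi (h s) v -> e <= `|y - v|.
  move=> k; apply: contrapT => /forallNP nk; apply: nlsc.
  apply/nbhs_ballP; exists k.+1%:R^-1 => [|s]; first by rewrite /= invr_gt0.
  rewrite -ball_normE /= => zs; apply: contrapT => nv; apply: (nk s); split=> // v Pv.
  by rewrite leNgt; apply/negP => yv; apply: nv; exists v.
have [|||] := lPhi nat leq (h \o x) (h z) y _ _ (hA z) _ Py.
- split=> //; first exact: (inhabits 0%N).
  + by move=> i j k; apply: leq_trans.
  + by move=> i j; exists (maxn i j); rewrite leq_maxl leq_maxr.
- by move=> i; apply: hA.
- move=> B /hc/nbhs_ballP[r /= r0 rB].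
  have [N _ NP] : \forall k \near \oo, k.+1%:R^-1 < r.
    by have /cvgr_lt := @cvg_harmonic R; apply.
  exists N => // k /= Nk; apply: rB; rewrite -ball_normE /=.
  by have [xk _] := xP k; apply: lt_trans xk (NP _ Nk).
move=> J [leJ [phi [v [[_ refl _ _] _ vy vP]]]].
have [j _ /(_ j (refl j))] := vy _ (nbhsx_ballx y e e0).
rewrite -ball_normE /= => yv; have [_ /(_ _ (vP j))] := xP (phi j).
by rewrite leNgt yv.
Qed.

(** * Games in block form *)

Section BlockSpace.
Context {R : realType} {p : nat} (d : 'I_p -> nat).
Let V := 'rV[R]_(\sum_(nu < p) d nu).

Lemma coord_block (x : V) j :
  x ord0 j = submxrow x (tagnat.sig1 j) ord0 (tagnat.sig2 j).
Proof. by rewrite -{1}(submxrowK x) mxE. Qed.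

Lemma submxrow_conv (x y : V) (a b : R) nu :
  submxrow (a *: x + b *: y) nu = a *: submxrow x nu + b *: submxrow y nu.
Proof. by apply/rowP => i; rewrite !mxE. Qed.

Lemma submxrow_continuous nu : continuous (fun x : V => submxrow x nu).
Proof.
apply: continuous_row => i.
rewrite [X in continuous X](_ : _ = (fun x : V => x ord0 (tagnat.Rank nu i))).
  exact: coord_continuous.
by apply/funext => x; rewrite mxE.
Qed.

Lemma other_blocks_continuous nu :
  continuous (other_blocks nu : V -> others R d nu).
Proof.
move=> z; have FF : Filter (other_blocks nu @ z) by apply: fmap_filter; apply: nbhs_filter.
apply/cvg_sup => mu.
apply: (@continuous_comp_initial _ V _
  (fun w : forall mu : {mu : 'I_p | mu != nu}, 'rV[R]_(d (val mu)) => w mu)).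
exact: submxrow_continuous.
Qed.

Definition mix_blocks nu (y z : V) : V :=
  join_blocks (submxrow y nu) (other_blocks nu z).

Lemma submxrow_mix nu (y z : V) mu :
  submxrow (mix_blocks nu y z) mu = if nu == mu then submxrow y mu else submxrow z mu.
Proof. by rewrite mxrowK; case: eqP => // e; case: mu / e. Qed.

Lemma mix_blocks_continuous nu :
  continuous (fun q : V * V => mix_blocks nu q.2 q.1).
Proof.
apply: continuous_row => j.
rewrite [X in continuous X](_ : _ = (fun q : V * V =>
    (if nu == tagnat.sig1 j then q.2 else q.1) ord0 j)); last first.
  by apply/funext => q; rewrite coord_block submxrow_mix; case: ifP => _; rewrite -coord_block.
case: (nu == tagnat.sig1 j) => q.
  apply: (@continuous_comp _ _ _ snd (fun x : V => x ord0 j)); first exact: cvg_snd.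
  exact: coord_continuous.
apply: (@continuous_comp _ _ _ fst (fun x : V => x ord0 j)); first exact: cvg_fst.
exact: coord_continuous.
Qed.

Section NikaidoIsoda.
Variable theta : 'I_p -> V -> R.

Definition nikaido_isoda (z y : V) : R :=
  \sum_nu (theta nu z - theta nu (mix_blocks nu y z)).

Lemma nikaido_isoda_diag z : nikaido_isoda z z = 0.
Proof.
by apply: big1 => nu _; rewrite /mix_blocks join_blocks_other_blocks subrr.
Qed.

(** Changing block nu alone makes all other summands vanish; a bound on the whole sum thus yields
    the optimality of each player. *)
Lemma nikaido_isoda_join z nu (y : 'rV[R]_(d nu)) :
  nikaido_isoda z (join_blocks y (other_blocks nu z))
  = theta nu z - theta nu (join_blocks y (other_blocks nu z)).
Proof.
rewrite /nikaido_isoda (bigD1 nu) //= {1}/mix_blocks submxrow_join_blocks big1 ?addr0 //.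
move=> mu numu; rewrite -[X in theta mu X - _](join_blocks_other_blocks mu) /mix_blocks.
suff -> : submxrow (join_blocks y (other_blocks nu z)) mu = submxrow z mu by rewrite subrr.
have -> : join_blocks y (other_blocks nu z) =
    mix_blocks nu (join_blocks y (other_blocks nu z)) z.
  by rewrite /mix_blocks submxrow_join_blocks.
by rewrite submxrow_mix eq_sym (negPf numu).
Qed.

Lemma nikaido_isoda_continuous : (forall nu, continuous (theta nu)) ->
  continuous (fun q : V * V => nikaido_isoda q.1 q.2).
Proof.
move=> thetac; apply: (@continuous_sum R _ R^o) => nu _ q.
apply: (@continuousB R R^o _ (fun q : V * V => theta nu q.1)
   (fun q : V * V => theta nu (mix_blocks nu q.2 q.1))).
  by apply: (@continuous_comp _ _ _ fst (theta nu)); [apply: cvg_fst|apply: thetac].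
apply: (@continuous_comp _ _ _ (fun q : V * V => mix_blocks nu q.2 q.1) (theta nu)).
  exact: mix_blocks_continuous.
exact: thetac.
Qed.

(** [mix_blocks nu y z] is affine in y, and the convex [theta nu] enters with a minus sign. *)
Lemma nikaido_isoda_concave z :
  (forall nu (w : others R d nu), convex_function [set: 'rV[R]_(d nu)]
     (fun y : 'rV[R]_(d nu) => theta nu (join_blocks y w))) ->
  forall x y t, 0 <= t -> t <= 1 ->
  t * nikaido_isoda z x + (1 - t) * nikaido_isoda z y
    <= nikaido_isoda z (t *: x + (1 - t) *: y).
Proof.
move=> thetaC x y t t0 t1; rewrite /nikaido_isoda !mulr_sumr -big_split.
apply: ler_sum => nu _ /=.
have := thetaC nu (other_blocks nu z) (Itv01 t0 t1) (submxrow x nu) (submxrow y nu)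
  (mem_set I) (mem_set I).
rewrite /mix_blocks submxrow_conv.
set u := theta _ (join_blocks (_ + _) _); set v := theta _ _; set w := theta _ _.
move=> h; have {}h : u <= t * v + (1 - t) * w := h; lra.
Qed.

End NikaidoIsoda.
End BlockSpace.

Lemma choice_dep (I : Type) (T : I -> Type) (Q : forall i, T i -> Prop) :
  (forall i, exists y, Q i y) -> exists f : forall i, T i, forall i, Q i (f i).
Proof. by move=> QT; exists (fun i => sval (cid (QT i))) => i; apply: svalP. Qed.

(** * Existence of a projected solution, through a map of improving replies *)

Theorem theorem5p5 (R : realType) (p : nat) (hp : (1 <= p)%N)
    (d : 'I_p -> nat)
    (C : forall nu : 'I_p, set 'rV[R]_(d nu))
    (theta : 'I_p -> block_space R d -> R)
    (K : forall nu : 'I_p, others R d nu -> set 'rV[R]_(d nu))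
    (C_nonempty : forall nu, C nu !=set0)
    (C_closed : forall nu, closed (C nu))
    (C_convex : forall nu, convex_set (C nu))
    (theta_continuous : forall nu, continuous (theta nu))
    (theta_convex : forall nu (w : others R d nu),
      convex_function [set: 'rV[R]_(d nu)]
        (fun y : 'rV[R]_(d nu) => theta nu (join_blocks y w)))
    (K_lsc : forall nu, lsc_on (prod_others C (nu := nu)) (K nu))
    (K_nonempty : forall nu (w : others R d nu),
      prod_others C w -> K nu w !=set0)
    (K_convex : forall nu (w : others R d nu),
      prod_others C w -> convex_set (K nu w))
    (K_relatively_compact : forall nu,
      precompact (\bigcup_(w in prod_others C (nu := nu)) K nu w))
    (D_closed : closed [set xz : block_space R d * block_space R d |
      [/\ prod_set C xz.1, metric_proj (prod_set C) xz.2 xz.1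
        & prod_map K xz.1 xz.2]]) :
  exists x : block_space R d, projected_solution C K theta x.
Proof.
pose V := 'rV[R]_(\sum_(nu < p) d nu).
have prod_closed : closed (prod_set C : set V).
  rewrite (_ : prod_set C = \bigcap_nu [set x : V | C nu (submxrow x nu)]); last first.
    by apply/seteqP; split=> x h nu; [move=> _|]; apply: h.
  apply: closed_bigI => nu _.
  by apply: preimage_closed => // x _; apply: submxrow_continuous.
have prod_nonempty : (prod_set C : set V) !=set0.
  have /choice_dep[y yP] : forall nu, exists y, C nu y by move=> nu; apply: C_nonempty.
  by exists (\mxrow_nu y nu) => nu; rewrite mxrowK.
have prod_convex : convex_set (prod_set C : set V).
  apply/convex_setP => x y t t0 t1 Cx Cy nu; rewrite submxrow_conv.
  by have /convex_setP := C_convex nu; apply.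
have [P Pc PP] := metric_proj_continuous prod_nonempty prod_closed prod_convex.
have PC nu z : prod_others C (other_blocks nu (P z)).
  by move=> mu; case: (PP z) => + _; apply.
pose F z : set V := prod_map K (P z).
pose Psi := nikaido_isoda theta.
apply: contrapT => nosol.
(* A fixed point z of [F] without improvement would make [P z] a projected solution with witness
   z. *)
have improve z : F z z -> exists2 y, F z y & 0 < Psi z y.
  move=> Fz; apply: contrapT => none; apply: nosol; exists (P z); split; first by case: (PP z).
  exists z; split=> // nu; split=> [|y Ky]; first exact: Fz.
  rewrite join_blocks_other_blocks -subr_le0 -nikaido_isoda_join leNgt; apply/negP => Psi0.
  apply: none; exists (join_blocks y (other_blocks nu z)) => // mu.
  have [e|munu] := eqVneq nu mu; first by case: mu / e; rewrite submxrow_join_blocks.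
  have := submxrow_mix nu (join_blocks y (other_blocks nu z)) z mu.
  by rewrite /mix_blocks submxrow_join_blocks (negPf munu) => ->; apply: Fz.
have fix_closed : closed [set z | F z z].
  rewrite (_ : [set z | F z z] = (fun z => (P z, z)) @^-1` [set xz : V * V |
      [/\ prod_set C xz.1, metric_proj (prod_set C) xz.2 xz.1 & prod_map K xz.1 xz.2]]).
    apply: preimage_closed => // z _.
    by apply: (@cvg_pair _ _ _ (nbhs z) (nbhs (P z)) (nbhs z)); [apply: Pc|apply: cvg_id].
  by apply/seteqP; split=> [z Fz|z []//]; split=> //; case: (PP z).
(* The implication merges the two cases: it is vacuous when z is not a fixed point of [F]. *)
pose H z := [set y | F z y /\ (F z z -> 0 < Psi z y)].
have Flsc : lsc F.
  move=> z y e e0 Fy.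
  have : \forall s \near z, forall nu, exists2 v, K nu (other_blocks nu (P s)) v &
      `|submxrow y nu - v| < e.
    apply: (@filter_forall _ _ _ (nbhs z)) => nu.
    apply: (lsc_on_lsc (h := fun s => other_blocks nu (P s)) (@K_lsc nu)) => //.
      by move=> s; apply: continuous_comp; [apply: Pc|apply: other_blocks_continuous].
  apply: filterS => s near_y.
  have /choice_dep[v vP] : forall nu, exists v, K nu (other_blocks nu (P s)) v /\
      `|submxrow y nu - v| < e by move=> nu; have [v ? ?] := near_y nu; exists v.
  exists (\mxrow_nu v nu); first by move=> nu; rewrite mxrowK; case: (vP nu).
  apply/row_norm_ltP => // j; rewrite coord_block.
  set mu := tagnat.sig1 j.
  have -> : submxrow (y - \mxrow_nu v nu) mu = submxrow y mu - v mu.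
    by rewrite -[in RHS](mxrowK v); apply/rowP => i; rewrite !mxE.
  by move: (vP mu) => [_]; move/row_norm_ltP; apply.
have Psi_cont : continuous (fun q : V * V => Psi q.1 q.2).
  exact: nikaido_isoda_continuous.
have Hlsc : lsc H.
  move=> z y e e0 [Fy Hy]; have [Fz|nFz] := pselect (F z z); last first.
    have : \forall s \near z, ~ F s s.
      by apply: open_nbhs_nbhs; split=> //; apply: closed_openC.
    by apply: filterS2 (Flsc z y e e0 Fy) => s [v Fv yv] nFs; exists v.
  (* Positivity of [Psi] persists near (z, y), so nearby points of [F s] lie in [H s] whether or not
     s is a fixed point. *)
  have := Psi_cont (z, y); move=> /cvgr_gt/(_ _ (Hy Fz))/nbhs_ballP[r /= r0 rP].
  have er : 0 < Num.min e r by rewrite lt_min e0.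
  have zr : \forall s \near z, ball z r s by apply: nbhsx_ballx.
  apply: filterS2 (Flsc z y _ er Fy) zr => s [v Fv]; rewrite lt_min => /andP[yv yv'] zs.
  exists v => //; split=> // _; apply: (rP (s, v)); split=> //=.
  by rewrite -ball_normE.
have H0 z : H z !=set0.
  have [/[dup] Fz /improve[y Fy Psiy]|nFz] := pselect (F z z); first by exists y.
  have /choice_dep[y yP] : forall nu, exists y, K nu (other_blocks nu (P z)) y.
    by move=> nu; apply: K_nonempty.
  by exists (\mxrow_nu y nu); split=> // nu; rewrite mxrowK.
have Hconv z : convex_set (H z).
  apply/convex_setP => x y t t0 t1 [Fx Hx] [Fy Hy]; split.
    move=> nu; rewrite submxrow_conv.
    by have /convex_setP := K_convex nu _ (PC nu z); apply.
  move=> Fz; apply: lt_le_trans (nikaido_isoda_concave z theta_convex x y t0 t1).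
  have := Hx Fz; have := Hy Fz; rewrite -/Psi => h1 h2.
  have [->|t_neq0] := eqVneq t 0; first by rewrite mul0r add0r subr0 mul1r.
  by rewrite ltr_pwDl ?mulr_ge0 ?subr_ge0 ?(ltW h1) // mulr_gt0 // lt_neqAle eq_sym t_neq0.
have /choice[M MP] : forall nu, exists M : R, forall z y,
    K nu (other_blocks nu (P z)) y -> `|y| <= M.
  move=> nu.
  have := K_relatively_compact nu; rewrite precompactE => /compact_bounded[M [_ MP]].
  exists (M + 1) => z y Ky; apply: (MP (M + 1)); first by rewrite ltrDl.
  by apply: subset_closure; exists (other_blocks nu (P z)).
have [z [Fz /(_ Fz)]] : exists z, H z z.
  (* In the sup norm it is enough to bound each block; the absolute values make the sum exceed every
     [M nu]. *)
  apply: (lsc_fixed_point (M := \sum_nu `|M nu|)) => // z y [Fy _].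
  apply/row_norm_leP => [|j]; first exact: sumr_ge0.
  rewrite coord_block; apply: le_trans (coord_le_norm _ _) _.
  apply: le_trans (MP _ _ _ (Fy _)) _; apply: le_trans (ler_norm _) _.
  by rewrite (bigD1 (tagnat.sig1 j)) //= lerDl sumr_ge0.
by rewrite /Psi nikaido_isoda_diag ltxx.
Qed.
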